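(* Let $A$ be a ring. The covering construction defines a functor of additive categories $$B:\mathbb{S}(A)\to\mathbb{B}(A[z,z^{-1}]),\qquad (P,e)\mapsto B(P,e)$$ such that: (i) Every Blanchfield $A[z,z^{-1}]$-module is isomorphic to the covering $B(P,e)$ of some Seifert $A$-module $(P,e)$. (ii) For every Seifert $A$-module $(P,e)$ the coverings of the morphisms $e,1-e:(P,e)\to(P,e)$ are automorphisms $$B(e)=(1-z)^{-1},\quad B(1-e)=(1-z^{-1})^{-1}\;:\;B(P,e)\to B(P,e),$$ with inverses $B(e)^{-1}=1-z$ and $B(1-e)^{-1}=1-z^{-1}$. (iii) For Seifert $A$-modules $(P,e),(P',e')$, every morphism of Blanchfield $A[z,z^{-1}]$-modules $f:B(P,e)\to B(P',e')$ is of the form $$f=B(g)\,t^{-k}$$ for some morphism of Seifert $A$-modules $g:(P,e)\to(P',e')$ and some $k\geq 0$, where $t$ is the automorphism $$t=B(e(1-e))=((1-z)(1-z^{-1}))^{-1}:B(P,e)\to B(P,e).$$ (iv) Let $g_1,g_2:(P,e)\to(P',e')$ be morphisms of Seifert $A$-modules and let $k_1,k_2\geq 0$. Then $$B(g_1)t^{-k_1}=B(g_2)t^{-k_2}:B(P,e)\to B(P',e')$$ if and only if $$\big(g_1(e(1-e))^{k_2}-g_2(e(1-e))^{k_1}\big)(e(1-e))^{\ell}=0:P\to P'$$ for some $\ell\geq 0$.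
   Context: $A$ is an associative ring with $1$; $A[z,z^{-1}]$ is the Laurent polynomial extension ($z$ central). ''f.g.'' means finitely generated. For an $A$-module $P$, $P[z,z^{-1}]=A[z,z^{-1}]\otimes_A P$; a f.g. projective $A[z,z^{-1}]$-module is induced if it is of the form $P[z,z^{-1}]$ with $P$ a f.g. projective $A$-module. A Blanchfield $A[z,z^{-1}]$-module $B$ is an $A[z,z^{-1}]$-module such that (a) $1-z:B\to B$ is an automorphism, and (b) there is a resolution $0\to P_1[z,z^{-1}]\to P_0[z,z^{-1}]\to B\to 0$ by induced f.g. projective $A[z,z^{-1}]$-modules. The Blanchfield category $\mathbb{B}(A[z,z^{-1}])$ has Blanchfield modules as objects and $A[z,z^{-1}]$-module morphisms as morphisms. A Seifert $A$-module $(P,e)$ is a f.g. projective $A$-module $P$ with an endomorphism $e:P\to P$. A morphism $g:(P,e)\to(P',e')$ is an $A$-module morphism $g:P\to P'$ with $e'g=ge$. These form the Seifert category $\mathbb{S}(A)$. The covering of $(P,e)$ is the Blanchfield module $B(P,e)=\mathrm{coker}(1-e+ze:P[z,z^{-1}]\to P[z,z^{-1}])$. The covering of a morphism $g:(P,e)\to(P',e')$ is the morphism $B(g):B(P,e)\to B(P',e')$, $x\mapsto g(x)$, induced on cokernels by $g:P[z,z^{-1}]\to P'[z,z^{-1}]$. *)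

(* Defs.v *)
From HB Require Import structures.
From mathcomp Require Import all_boot all_algebra finmap.
From mathcomp Require Import boolp.
From mathcomp Require Import xfinmap monalg.

Set Implicit Arguments.
Unset Strict Implicit.
Unset Printing Implicit Defensive.

Import GRing.Theory.

Local Open Scope fset_scope.
Local Open Scope ring_scope.

(* Modules are left modules; A : pzRingType may be noncommutative or zero.    *)
(* The axioms of boolp provide the quotient by a non-decidable submodule.     *)

Record preadditive := Preadditive {
  obj :> Type;
  mor : obj -> obj -> zmodType;
  idm : forall X, mor X X;
  mcomp : forall X Y Z, mor Y Z -> mor X Y -> mor X Z;
  compA : forall X Y Z T (f : mor X Y) (g : mor Y Z) (h : mor Z T),
    mcomp h (mcomp g f) = mcomp (mcomp h g) f;
  comp1m : forall X Y (f : mor X Y), mcomp (idm Y) f = f;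
  compm1 : forall X Y (f : mor X Y), mcomp f (idm X) = f;
  compDl : forall X Y Z (g h : mor Y Z) (f : mor X Y),
    mcomp (g + h) f = mcomp g f + mcomp h f;
  compDr : forall X Y Z (h : mor Y Z) (f g : mor X Y),
    mcomp h (f + g) = mcomp h f + mcomp h g
}.
Arguments mor {p} X Y : rename.
Arguments idm {p} X : rename.
Arguments mcomp {p X Y Z} g f : rename.

Declare Scope cat_scope.
Delimit Scope cat_scope with cat.
Notation "g \oc f" := (mcomp g f) (at level 40, left associativity) : cat_scope.
Local Open Scope cat_scope.

Definition expm (C : preadditive) (X : C) (f : mor X X) (n : nat) : mor X X :=
  iter n (mcomp f) (idm X).
Notation "f ^oc n" := (expm f n) (at level 29, left associativity) : cat_scope.

Definition inverses (C : preadditive) (X Y : C) (f : mor X Y) (g : mor Y X) :=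
  g \oc f = idm X /\ f \oc g = idm Y.

Definition isomorphic (C : preadditive) (X Y : C) :=
  exists (f : mor X Y) (g : mor Y X), inverses f g.

Definition is_zero_object (C : preadditive) (Z : C) :=
  forall X : C, (exists! f : mor X Z, True) /\ (exists! f : mor Z X, True).

Definition is_biproduct (C : preadditive) (X Y S : C)
    (i1 : mor X S) (i2 : mor Y S) (p1 : mor S X) (p2 : mor S Y) :=
  [/\ p1 \oc i1 = idm X, p2 \oc i2 = idm Y, p2 \oc i1 = 0, p1 \oc i2 = 0
    & i1 \oc p1 + i2 \oc p2 = idm S].

Definition is_additive_category (C : preadditive) :=
  (exists Z : C, is_zero_object Z) /\
  (forall X Y : C, exists (S : C) (i1 : mor X S) (i2 : mor Y S)
     (p1 : mor S X) (p2 : mor S Y), is_biproduct i1 i2 p1 p2).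

Definition is_additive_functor (C D : preadditive) (F : C -> D)
    (Fm : forall X Y : C, mor X Y -> mor (F X) (F Y)) :=
  [/\ forall X : C, Fm X X (idm X) = idm (F X),
      forall (X Y Z : C) (g : mor Y Z) (f : mor X Y),
        Fm X Z (g \oc f) = Fm Y Z g \oc Fm X Y f
    & forall (X Y : C) (f g : mor X Y), Fm X Y (f + g) = Fm X Y f + Fm X Y g].

Section LinearZmodule.
Context {R : pzRingType} {U V : lmodType R}.
Implicit Types f g h : {linear U -> V}.

Lemma linear_eq f g : f =1 g -> f = g.
Proof.
case: f g => [f [[fa] [fb]]] [g [[ga] [gb]]] /= /funext fg; subst g.
by congr GRing.Linear.Pack; congr GRing.Linear.Class; congr (_ _);
  apply: Prop_irrelevance.
Qed.

HB.instance Definition _ := gen_eqMixin {linear U -> V}.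
HB.instance Definition _ := gen_choiceMixin {linear U -> V}.

Definition linear_zero : {linear U -> V} := \0.
Definition linear_opp f : {linear U -> V} := \- f.
Definition linear_add f g : {linear U -> V} := f \+ g.

Fact linear_addA : associative linear_add.
Proof. by move=> f g h; apply: linear_eq => x /=; rewrite addrA. Qed.
Fact linear_addC : commutative linear_add.
Proof. by move=> f g; apply: linear_eq => x /=; rewrite addrC. Qed.
Fact linear_add0 : left_id linear_zero linear_add.
Proof. by move=> f; apply: linear_eq => x /=; rewrite add0r. Qed.
Fact linear_addN : left_inverse linear_zero linear_opp linear_add.
Proof. by move=> f; apply: linear_eq => x /=; rewrite addNr. Qed.

HB.instance Definition _ := GRing.isZmodule.Build {linear U -> V}
  linear_addA linear_addC linear_add0 linear_addN.

Lemma linear_zeroE x : (0 : {linear U -> V}) x = 0. Proof. by []. Qed.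
Lemma linear_oppE f x : (- f) x = - f x. Proof. by []. Qed.
Lemma linear_addE f g x : (f + g) x = f x + g x. Proof. by []. Qed.
Lemma linear_subE f g x : (f - g) x = f x - g x. Proof. by []. Qed.
End LinearZmodule.

Definition linear_id {R : pzRingType} (U : lmodType R) : {linear U -> U} :=
  idfun.
Definition linear_comp {R : pzRingType} (U V W : lmodType R)
    (g : {linear V -> W}) (f : {linear U -> V}) : {linear U -> W} := g \o f.

Definition finitely_generated (R : pzRingType) (M : lmodType R) :=
  exists (n : nat) (s : 'I_n -> M),
    forall x : M, exists a : 'I_n -> R, x = \sum_i a i *: s i.

Definition projective (R : pzRingType) (P : lmodType R) :=
  forall (M N : lmodType R) (p : {linear M -> N}) (f : {linear P -> N}),
    (forall y : N, exists x : M, p x = y) ->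
    exists h : {linear P -> M}, forall x, p (h x) = f x.

Definition fg_projective (R : pzRingType) (P : lmodType R) :=
  finitely_generated P /\ projective P.

Definition exact_at (R : pzRingType) (U V W : lmodType R)
    (f : {linear U -> V}) (g : {linear V -> W}) :=
  forall y : V, g y = 0 <-> exists x : U, f x = y.

Section Image.
Context {R : pzRingType} {U V : lmodType R} (d : {linear U -> V}).

Definition in_image : {pred V} := fun y => `[< exists x : U, d x = y >].

Lemma in_imageP y : reflect (exists x : U, d x = y) (y \in in_image).
Proof. exact: asboolP. Qed.

Fact in_image_zmod_closed : zmod_closed in_image.
Proof.
split=> [|_ _ /in_imageP[x <-] /in_imageP[y <-]]; apply/in_imageP.
  by exists 0; rewrite raddf0.
by exists (x - y); rewrite raddfB.
Qed.

HB.instance Definition _ := GRing.isZmodClosed.Build V in_image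
  in_image_zmod_closed.

End Image.

Section Cokernel.
Context {R : pzRingType} {U V : lmodType R} (d : {linear U -> V}).
Local Open Scope quotient_scope.

Definition coker : Type := Quotient.quot (in_image d).
HB.instance Definition _ := GRing.Zmodule.on coker.

Definition coker_proj (x : V) : coker := \pi_(Quotient.quot (in_image d)) x.

Lemma coker_projP (x y : V) :
  coker_proj x = coker_proj y <-> exists u, d u = x - y.
Proof.
split=> [/eqP|xy]; last apply/eqP.
  by rewrite -Quotient.idealrBE => /in_imageP.
by rewrite -Quotient.idealrBE; apply/in_imageP.
Qed.

Lemma coker_proj_surj (q : coker) : exists x, coker_proj x = q.
Proof. by exists (repr (q : Quotient.quot (in_image d))); apply: reprK. Qed.

Fact coker_proj_zmod_morphism : zmod_morphism coker_proj.
Proof.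
by move=> x y; exact: (raddfB (\pi_(Quotient.quot (in_image d)))).
Qed.
HB.instance Definition _ :=
  GRing.isZmodMorphism.Build V coker coker_proj coker_proj_zmod_morphism.

Definition coker_scale (a : R) (q : coker) : coker :=
  coker_proj (a *: repr (q : Quotient.quot (in_image d))).

Lemma coker_scaleE a x : coker_scale a (coker_proj x) = coker_proj (a *: x).
Proof.
rewrite /coker_scale; apply/coker_projP.
have /coker_projP[u du] : coker_proj (repr (coker_proj x :
  Quotient.quot (in_image d))) = coker_proj x by exact: reprK.
by exists (a *: u); rewrite linearZ /= du scalerBr.
Qed.

Fact coker_scaleA a b q :
  coker_scale a (coker_scale b q) = coker_scale (a * b) q.
Proof.
by have [x <-] := coker_proj_surj q; rewrite !coker_scaleE scalerA.
Qed.
Fact coker_scale1 : left_id 1 coker_scale.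
Proof.
by move=> q; have [x <-] := coker_proj_surj q; rewrite coker_scaleE scale1r.
Qed.
Fact coker_scaleDr : right_distributive coker_scale +%R.
Proof.
move=> a q r; have [x <-] := coker_proj_surj q.
have [y <-] := coker_proj_surj r.
by rewrite -raddfD !coker_scaleE scalerDr raddfD.
Qed.
Fact coker_scaleDl q : {morph coker_scale^~ q : a b / a + b}.
Proof.
move=> a b; have [x <-] := coker_proj_surj q.
by rewrite !coker_scaleE scalerDl raddfD.
Qed.

HB.instance Definition _ := GRing.Zmodule_isLmodule.Build R coker
  coker_scaleA coker_scale1 coker_scaleDr coker_scaleDl.

Fact coker_proj_scalable : scalable coker_proj.
Proof. by move=> a x; rewrite -coker_scaleE. Qed.
HB.instance Definition _ :=
  GRing.isScalable.Build R V coker *:%R coker_proj coker_proj_scalable.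

End Cokernel.

Section CokernelMap.
Context {R : pzRingType} {U V U' V' : lmodType R}.
Context (d : {linear U -> V}) (d' : {linear U' -> V'}).
Context (h : {linear U -> U'}) (g : {linear V -> V'}).
Context (gd : forall x, g (d x) = d' (h x)).
Local Open Scope quotient_scope.

Definition coker_map (q : coker d) : coker d' :=
  coker_proj d' (g (repr (q : Quotient.quot (in_image d)))).

Lemma coker_mapE x : coker_map (coker_proj d x) = coker_proj d' (g x).
Proof.
rewrite /coker_map; apply/coker_projP.
have /coker_projP[u du] : coker_proj d (repr (coker_proj d x :
  Quotient.quot (in_image d))) = coker_proj d x by exact: reprK.
by exists (h u); rewrite -gd du raddfB.
Qed.

Fact coker_map_linear : linear coker_map.
Proof.
move=> a q r; have [x <-] := coker_proj_surj q.
have [y <-] := coker_proj_surj r.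
by rewrite -linearP !coker_mapE !linearP.
Qed.
End CokernelMap.

(* {laurent V} is V[z,z^-1]: a finitely supported family of coefficients      *)
(* x@_k : V, k : int, stands for \sum_k x@_k z^k.                             *)
Definition laurent (V : zmodType) : Type := {malg V[int]}.
HB.instance Definition _ (V : zmodType) := GRing.Zmodule.on (laurent V).
Notation "{ 'laurent' V }" := (laurent V)
  (at level 0, V at level 2, format "{ 'laurent'  V }") : type_scope.

(* v z^k *)
Definition zmonom {V : zmodType} (k : int) (v : V) : {laurent V} := mkmalgU k v.

HB.instance Definition _ (V : zmodType) (k : int) :=
  GRing.Additive.copy (@zmonom V k) (@mkmalgU int V k).

Lemma laurent_eq (V : zmodType) (x y : {laurent V}) :
  (forall k, x@_k = y@_k) -> x = y.
Proof. by move/malgP. Qed.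

Lemma laurent_sum (V : zmodType) (x : {laurent V}) :
  x = \sum_(k <- msupp x) zmonom k x@_k.
Proof. exact: monalgE. Qed.

Lemma laurent_ind (V : zmodType) (Q : {laurent V} -> Prop) :
  (forall k v, Q (zmonom k v)) -> (forall x y, Q x -> Q y -> Q (x + y)) ->
  forall x, Q x.
Proof.
move=> Qm QD x; rewrite (laurent_sum x); apply: big_ind => //.
have <- : @zmonom V 0 0 = 0 by exact: raddf0.
exact: Qm.
Qed.

Lemma laurent_additive_eq (V W : zmodType) (f g : {additive {laurent V} -> W}) :
  (forall k v, f (zmonom k v) = g (zmonom k v)) -> f =1 g.
Proof.
move=> fg; apply: laurent_ind => // x y fgx fgy.
by rewrite !raddfD fgx fgy.
Qed.

Section LaurentExtend.
Context {V W : zmodType} (f : int -> {additive V -> W}).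

Definition laurent_extend (x : {laurent V}) : W :=
  \sum_(k <- msupp x) f k x@_k.

Lemma laurent_extendw (D : {fset int}) (x : {laurent V}) :
  msupp x `<=` D -> laurent_extend x = \sum_(k <- D) f k x@_k.
Proof.
move=> sxD; apply: big_fset_incl => // k _ /mcoeff_outdom ->.
by rewrite raddf0.
Qed.

Fact laurent_extend_zmod_morphism : zmod_morphism laurent_extend.
Proof.
move=> x y; rewrite (laurent_extendw (msuppB_le _ _)).
rewrite (laurent_extendw (fsubsetUl _ (msupp y))).
rewrite (laurent_extendw (fsubsetUr (msupp x) _)) -sumrB.
by apply: eq_bigr => k _; rewrite mcoeffB raddfB.
Qed.
HB.instance Definition _ := GRing.isZmodMorphism.Build {laurent V} W
  laurent_extend laurent_extend_zmod_morphism.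

Lemma laurent_extendE k v : laurent_extend (zmonom k v) = f k v.
Proof.
by rewrite (laurent_extendw msuppU_le) big_seq_fset1 mcoeffUU.
Qed.
End LaurentExtend.

Section Convolution.
Context {U V W : zmodType} (b : U -> V -> W).
Implicit Types (x : {laurent U}) (y : {laurent V}).

Definition conv x y : {laurent W} :=
  \sum_(i <- msupp x) \sum_(j <- msupp y) zmonom (i + j) (b x@_i y@_j).

Context (bBl : forall v, zmod_morphism (b^~ v)).
Context (bBr : forall u, zmod_morphism (b u)).

Let b0l v : b 0 v = 0.
Proof. by rewrite -(subrr (0 : U)) bBl subrr. Qed.
Let b0r u : b u 0 = 0.
Proof. by rewrite -(subrr (0 : V)) bBr subrr. Qed.

Lemma convw (D E : {fset int}) x y : msupp x `<=` D -> msupp y `<=` E ->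
  conv x y = \sum_(i <- D) \sum_(j <- E) zmonom (i + j) (b x@_i y@_j).
Proof.
move=> xD yE; rewrite /conv (big_fset_incl _ xD) /=.
  apply: eq_bigr => i _; apply: big_fset_incl => // j _ /mcoeff_outdom ->.
  by rewrite b0r raddf0.
move=> i _ /mcoeff_outdom ->.
by rewrite big1 // => j _; rewrite b0l raddf0.
Qed.

Lemma convBl y : zmod_morphism (conv^~ y).
Proof.
move=> x1 x2; rewrite (convw (msuppB_le _ _) (fsubset_refl _)).
rewrite (convw (fsubsetUl _ (msupp x2)) (fsubset_refl _)).
rewrite (convw (fsubsetUr (msupp x1) _) (fsubset_refl _)) -sumrB.
apply: eq_bigr => i _; rewrite -sumrB.
by apply: eq_bigr => j _; rewrite mcoeffB bBl raddfB.
Qed.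

Lemma convBr x : zmod_morphism (conv x).
Proof.
move=> y1 y2; rewrite (convw (fsubset_refl _) (msuppB_le _ _)).
rewrite (convw (fsubset_refl _) (fsubsetUl _ (msupp y2))).
rewrite (convw (fsubset_refl _) (fsubsetUr (msupp y1) _)) -sumrB.
apply: eq_bigr => i _; rewrite -sumrB.
by apply: eq_bigr => j _; rewrite mcoeffB bBr raddfB.
Qed.

Let conv0l y : conv 0 y = 0.
Proof. by rewrite -(subrr (0 : {laurent U})) convBl subrr. Qed.
Let conv0r x : conv x 0 = 0.
Proof. by rewrite -(subrr (0 : {laurent V})) convBr subrr. Qed.

Lemma convDl y : {morph conv^~ y : x1 x2 / x1 + x2}.
Proof.
by move=> x1 x2; rewrite -{1}[x2]opprK -[- x2]sub0r !convBl conv0l sub0r opprK.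
Qed.

Lemma convDr x : {morph conv x : y1 y2 / y1 + y2}.
Proof.
by move=> y1 y2; rewrite -{1}[y2]opprK -[- y2]sub0r !convBr conv0r sub0r opprK.
Qed.

Lemma conv_monom i j u v :
  conv (zmonom i u) (zmonom j v) = zmonom (i + j) (b u v).
Proof. by rewrite (convw msuppU_le msuppU_le) !big_seq_fset1 !mcoeffUU. Qed.
End Convolution.

Section LaurentRing.
Context {A : pzRingType}.

(* (\sum_i a_i z^i) (\sum_j b_j z^j) = \sum_(i, j) a_i b_j z^(i + j) *)
Definition laurent_mul : {laurent A} -> {laurent A} -> {laurent A} :=
  conv *%R.
Definition laurent_one : {laurent A} := zmonom 0 1.

Let mulBl (v : A) : zmod_morphism ( *%R^~ v).
Proof. by move=> a c; rewrite mulrBl. Qed.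
Let mulBr (u : A) : zmod_morphism ( *%R u).
Proof. by move=> a c; rewrite mulrBr. Qed.

Fact laurent_mulDl : left_distributive laurent_mul +%R.
Proof. by move=> x y u; exact: (convDl mulBl mulBr). Qed.
Fact laurent_mulDr : right_distributive laurent_mul +%R.
Proof. by move=> x y u; exact: (convDr mulBl mulBr). Qed.
Fact laurent_mul_monom i j (a c : A) :
  laurent_mul (zmonom i a) (zmonom j c) = zmonom (i + j) (a * c).
Proof. exact: (conv_monom mulBl mulBr). Qed.

Fact laurent_mulA : associative laurent_mul.
Proof.
move=> x y u; elim/laurent_ind: x => [i a|x1 x2]; last first.
  by rewrite !laurent_mulDl => -> ->.
elim/laurent_ind: y => [j c|y1 y2]; last first.
  by rewrite laurent_mulDl !laurent_mulDr laurent_mulDl => -> ->.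
elim/laurent_ind: u => [k e|u1 u2]; last by rewrite !laurent_mulDr => -> ->.
by rewrite !laurent_mul_monom addrA mulrA.
Qed.
Fact laurent_mul1l : left_id laurent_one laurent_mul.
Proof.
elim/laurent_ind => [k v|x y]; last by rewrite laurent_mulDr => -> ->.
by rewrite laurent_mul_monom add0r mul1r.
Qed.
Fact laurent_mul1r : right_id laurent_one laurent_mul.
Proof.
elim/laurent_ind => [k v|x y]; last by rewrite laurent_mulDl => -> ->.
by rewrite laurent_mul_monom addr0 mulr1.
Qed.
End LaurentRing.

HB.instance Definition _ (A : pzRingType) :=
  GRing.Zmodule_isPzRing.Build {laurent A} (@laurent_mulA A)
    laurent_mul1l laurent_mul1r laurent_mulDl laurent_mulDr.

Section LaurentModule.
Context {A : pzRingType} {M : lmodType A}.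

(* (\sum_i a_i z^i) (\sum_j x_j z^j) = \sum_(i, j) a_i x_j z^(i + j) *)
Definition laurent_scale : {laurent A} -> {laurent M} -> {laurent M} :=
  conv *:%R.

Let scaleBl (v : M) : zmod_morphism ( *:%R^~ v : A -> M).
Proof. by move=> a c; rewrite scalerBl. Qed.
Let scaleBr (u : A) : zmod_morphism ( *:%R u : M -> M).
Proof. by move=> a c; rewrite scalerBr. Qed.

Fact laurent_scaleDl x : {morph laurent_scale^~ x : u v / u + v}.
Proof. exact: (convDl scaleBl scaleBr). Qed.
Fact laurent_scaleDr : right_distributive laurent_scale +%R.
Proof. by move=> u; exact: (convDr scaleBl scaleBr). Qed.
Fact laurent_scale_monom i j (a : A) (v : M) :
  laurent_scale (zmonom i a) (zmonom j v) = zmonom (i + j) (a *: v).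
Proof. exact: (conv_monom scaleBl scaleBr). Qed.

Fact laurent_scaleA u v x :
  laurent_scale u (laurent_scale v x) = laurent_scale (u * v) x.
Proof.
elim/laurent_ind: u => [i a|u1 u2]; last first.
  by rewrite mulrDl !laurent_scaleDl => -> ->.
elim/laurent_ind: v => [j c|v1 v2]; last first.
  by rewrite mulrDr !laurent_scaleDl !laurent_scaleDr => -> ->.
elim/laurent_ind: x => [k e|x1 x2]; last by rewrite !laurent_scaleDr => -> ->.
by rewrite [_ * _]laurent_mul_monom !laurent_scale_monom addrA scalerA.
Qed.
Fact laurent_scale1 : left_id 1 laurent_scale.
Proof.
elim/laurent_ind => [k v|x y]; last by rewrite laurent_scaleDr => -> ->.
by rewrite laurent_scale_monom add0r scale1r.
Qed.
End LaurentModule.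

HB.instance Definition _ (A : pzRingType) (M : lmodType A) :=
  GRing.Zmodule_isLmodule.Build {laurent A} {laurent M}
    (@laurent_scaleA A M) laurent_scale1 laurent_scaleDr laurent_scaleDl.

Lemma laurent_mulE (A : pzRingType) i j (a c : A) :
  zmonom i a * zmonom j c = zmonom (i + j) (a * c).
Proof. exact: laurent_mul_monom. Qed.

Lemma laurent_scaleE (A : pzRingType) (M : lmodType A) i j (a : A) (v : M) :
  zmonom i a *: zmonom j v = zmonom (i + j) (a *: v).
Proof. exact: laurent_scale_monom. Qed.

(* {laurent M} is A[z,z^-1] \otimes_A M, with u \otimes v := u *: zmonom 0 v  *)
Lemma laurent_tensorP (A : pzRingType) (M : lmodType A) (G : zmodType)
    (b : {laurent A} -> M -> G) :
  (forall v, zmod_morphism (b^~ v)) -> (forall u, zmod_morphism (b u)) ->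
  (forall u (a : A) v, b (u * zmonom 0 a) v = b u (a *: v)) ->
  exists! h : {laurent M} -> G,
    zmod_morphism h /\ forall u v, h (u *: zmonom 0 v) = b u v.
Proof.
move=> bBl bBr bM.
pose bm k := GRing.isZmodMorphism.Build M G _ (bBr (zmonom k 1)).
pose ba k : {additive M -> G} := HB.pack (b (zmonom k 1)) (bm k).
exists (laurent_extend ba); split.
  split=> [|u v]; first exact: raddfB.
  pose bl := GRing.isZmodMorphism.Build {laurent A} G _ (bBl v).
  pose bv : {additive {laurent A} -> G} := HB.pack (b^~ v) bl.
  rewrite -[RHS]/(bv u); elim/laurent_ind: u => [k a|u1 u2].
    rewrite laurent_scaleE addr0 laurent_extendE /=.
    by rewrite -bM laurent_mulE addr0 mul1r.
  by rewrite scalerDl !raddfD /= => -> ->.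
move=> h [hB hE]; apply: funext => x.
pose hm := GRing.isZmodMorphism.Build {laurent M} G _ hB.
pose ha : {additive {laurent M} -> G} := HB.pack h hm.
rewrite -[RHS]/(ha x); elim/laurent_ind: x => [k v|x1 x2].
  by rewrite laurent_extendE /= -hE laurent_scaleE addr0 scale1r.
by rewrite !raddfD /= => -> ->.
Qed.

Section LaurentMap.
Context {A : pzRingType} {M N : lmodType A} (f : {linear M -> N}).

(* \sum_k x_k z^k |-> \sum_k f(x_k) z^k *)
Definition laurent_map (x : {laurent M}) : {laurent N} :=
  \sum_(k <- msupp x) zmonom k (f x@_k).

Let laurent_map_extend (x : {laurent M}) :
  laurent_map x = laurent_extend (fun k => zmonom k \o f) x.
Proof. by []. Qed.

Fact laurent_map_zmod_morphism : zmod_morphism laurent_map.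
Proof. by move=> x y; rewrite !laurent_map_extend raddfB. Qed.
HB.instance Definition _ := GRing.isZmodMorphism.Build {laurent M} {laurent N}
  laurent_map laurent_map_zmod_morphism.

Let laurent_mapD : {morph laurent_map : x y / x + y}.
Proof. exact: raddfD. Qed.

Lemma laurent_map_monom k v : laurent_map (zmonom k v) = zmonom k (f v).
Proof. by rewrite laurent_map_extend laurent_extendE. Qed.

Fact laurent_map_scalable : scalable laurent_map.
Proof.
move=> u x; elim/laurent_ind: u => [i a|u1 u2]; last first.
  by rewrite !scalerDl laurent_mapD => -> ->.
elim/laurent_ind: x => [k e|x1 x2]; last first.
  by rewrite scalerDr !laurent_mapD scalerDr => -> ->.
by rewrite laurent_scaleE !laurent_map_monom laurent_scaleE linearZ.
Qed.
HB.instance Definition _ := GRing.isScalable.Build {laurent A} {laurent M}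
  {laurent N} *:%R laurent_map laurent_map_scalable.

Lemma coeff_laurent_map k x : (laurent_map x)@_k = f x@_k.
Proof.
elim/laurent_ind: x => [i v|x y]; last first.
  by rewrite laurent_mapD !mcoeffD => -> ->; rewrite raddfD.
by rewrite laurent_map_monom !mcoeffU raddfMn.
Qed.
End LaurentMap.

(* z^k is central, so multiplication by z^k is A[z,z^-1]-linear. *)
Section ZAction.
Context {A : pzRingType}.

Definition zpow (k : int) : {laurent A} := zmonom k 1.

Lemma zpow_central k (u : {laurent A}) : zpow k * u = u * zpow k.
Proof.
elim/laurent_ind: u => [i a|u v]; last by rewrite mulrDl mulrDr => -> ->.
by rewrite !laurent_mulE mul1r mulr1 addrC.
Qed.

Section Scale.
Context {M : lmodType {laurent A}} (k : int).

Definition zscale (x : M) : M := zpow k *: x.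

Fact zscale_linear : linear zscale.
Proof.
by move=> u x y; rewrite /zscale scalerDr !scalerA zpow_central.
Qed.
HB.instance Definition _ :=
  GRing.isLinear.Build {laurent A} M M *:%R zscale zscale_linear.
End Scale.

Definition zmap (M : lmodType {laurent A}) : {linear M -> M} := zscale 1.
Definition zinvmap (M : lmodType {laurent A}) : {linear M -> M} := zscale (- 1).
End ZAction.

Definition is_blanchfield (A : pzRingType) (B : lmodType {laurent A}) :=
  bijective (linear_id B - zmap B) /\
  exists (P1 P0 : lmodType A) (d : {linear {laurent P1} -> {laurent P0}})
      (p : {linear {laurent P0} -> B}),
    [/\ fg_projective P1, fg_projective P0, injective d, exact_at d p
      & forall y : B, exists x, p x = y].

Record blanchfield (A : pzRingType) := Blanchfield {
  blanchfield_module :> lmodType {laurent A};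
  blanchfieldP : is_blanchfield blanchfield_module
}.

Section BlanchfieldCategory.
Context (A : pzRingType).

Definition blanchfield_hom (B B' : blanchfield A) : zmodType := {linear B -> B'}.

Program Definition blanchfield_category : preadditive := @Preadditive
  (blanchfield A) blanchfield_hom (fun B => linear_id B)
  (fun B C D g f => linear_comp g f) _ _ _ _ _.
Next Obligation. by apply: linear_eq. Qed.
Next Obligation. by apply: linear_eq. Qed.
Next Obligation. by apply: linear_eq. Qed.
Next Obligation. by apply: linear_eq. Qed.
Next Obligation. by apply: linear_eq => x; exact: raddfD. Qed.
End BlanchfieldCategory.

Record seifert (A : pzRingType) := Seifert {
  seifert_module :> lmodType A;
  seifert_endo : {linear seifert_module -> seifert_module};
  seifert_fgp : fg_projective seifert_module
}.

Record seifert_hom (A : pzRingType) (X X' : seifert A) := SeifertHom {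
  seifert_map :> {linear X -> X'};
  seifert_mapP :
    forall x, seifert_endo X' (seifert_map x) = seifert_map (seifert_endo X x)
}.

Section SeifertHom.
Context {A : pzRingType} {X X' : seifert A}.
Implicit Types f g : seifert_hom X X'.

Lemma seifert_hom_eq f g : f =1 g -> f = g.
Proof.
case: f g => [f fP] [g gP] /= /linear_eq fg; subst g.
by congr SeifertHom; apply: Prop_irrelevance.
Qed.

HB.instance Definition _ := gen_eqMixin (seifert_hom X X').
HB.instance Definition _ := gen_choiceMixin (seifert_hom X X').

Fact seifert_zeroP x :
  seifert_endo X' (@linear_zero A X X' x) = linear_zero (seifert_endo X x).
Proof. exact: raddf0. Qed.
Fact seifert_oppP f x :
  seifert_endo X' (linear_opp f x) = linear_opp f (seifert_endo X x).
Proof. by rewrite /= raddfN /= seifert_mapP. Qed.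
Fact seifert_addP f g x :
  seifert_endo X' (linear_add f g x) = linear_add f g (seifert_endo X x).
Proof. by rewrite /= raddfD /= !seifert_mapP. Qed.

Definition seifert_zero := SeifertHom seifert_zeroP.
Definition seifert_opp f := SeifertHom (seifert_oppP f).
Definition seifert_add f g := SeifertHom (seifert_addP f g).

Fact seifert_addA : associative seifert_add.
Proof. by move=> f g h; apply: seifert_hom_eq => x /=; apply: addrA. Qed.
Fact seifert_addC : commutative seifert_add.
Proof. by move=> f g; apply: seifert_hom_eq => x /=; apply: addrC. Qed.
Fact seifert_add0 : left_id seifert_zero seifert_add.
Proof. by move=> f; apply: seifert_hom_eq => x /=; apply: add0r. Qed.
Fact seifert_addN : left_inverse seifert_zero seifert_opp seifert_add.
Proof. by move=> f; apply: seifert_hom_eq => x /=; apply: addNr. Qed.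

HB.instance Definition _ := GRing.isZmodule.Build (seifert_hom X X')
  seifert_addA seifert_addC seifert_add0 seifert_addN.
End SeifertHom.

Section SeifertCategory.
Context (A : pzRingType).

Fact seifert_idP (X : seifert A) x :
  seifert_endo X (linear_id X x) = linear_id X (seifert_endo X x).
Proof. by []. Qed.

Fact seifert_compP (X Y Z : seifert A) (g : seifert_hom Y Z)
    (f : seifert_hom X Y) x :
  seifert_endo Z (linear_comp g f x) = linear_comp g f (seifert_endo X x).
Proof. by rewrite /= !seifert_mapP. Qed.

Definition seifert_id (X : seifert A) := SeifertHom (@seifert_idP X).
Definition seifert_comp (X Y Z : seifert A) (g : seifert_hom Y Z)
  (f : seifert_hom X Y) := SeifertHom (seifert_compP g f).

Program Definition seifert_category : preadditive := @Preadditive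
  (seifert A) (fun X X' => seifert_hom X X') seifert_id seifert_comp
  _ _ _ _ _.
Next Obligation. by apply: seifert_hom_eq. Qed.
Next Obligation. by apply: seifert_hom_eq. Qed.
Next Obligation. by apply: seifert_hom_eq. Qed.
Next Obligation. by apply: seifert_hom_eq. Qed.
Next Obligation. by apply: seifert_hom_eq => x; exact: raddfD. Qed.

Fact seifert_selfP (X : seifert A) x :
  seifert_endo X (seifert_endo X x) = seifert_endo X (seifert_endo X x).
Proof. by []. Qed.
Definition seifert_self (X : seifert_category) : mor X X :=
  SeifertHom (@seifert_selfP X).
End SeifertCategory.

Section Covering.
Context {A : pzRingType}.

(* 1 - e + z e : P[z,z^-1] -> P[z,z^-1] *)
Definition covering_map (X : seifert A) : {linear {laurent X} -> {laurent X}} :=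
  let e : {linear {laurent X} -> {laurent X}} :=
    laurent_map (seifert_endo X) in
  linear_id {laurent X} - e + linear_comp (zmap {laurent X}) e.

Lemma covering_mapE (X : seifert A) x :
  let e := laurent_map (seifert_endo X) in
  covering_map X x = x - e x + zpow 1 *: e x.
Proof. by []. Qed.

Definition covering (X : seifert A) : lmodType {laurent A} :=
  coker (covering_map X).

Fact covering_mapP (X X' : seifert A) (g : seifert_hom X X') x :
  laurent_map g (covering_map X x) = covering_map X' (laurent_map g x).
Proof.
have gD : {morph (laurent_map g : {laurent X} -> {laurent X'}) : y w / y + w}.
  exact: raddfD.
have gN : {morph (laurent_map g : {laurent X} -> {laurent X'}) : y / - y}.
  exact: raddfN.
have ge y : laurent_map g (laurent_map (seifert_endo X) y) =
            laurent_map (seifert_endo X') (laurent_map g y).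
  by apply: laurent_eq => k; rewrite !coeff_laurent_map seifert_mapP.
by rewrite !covering_mapE gD gD gN laurent_map_scalable !ge.
Qed.

Definition covering_hom (X X' : seifert A) (g : seifert_hom X X') :
    covering X -> covering X' :=
  @coker_map _ _ _ _ _ (covering_map X) (covering_map X') (laurent_map g).

Lemma covering_homE (X X' : seifert A) (g : seifert_hom X X') x :
  covering_hom g (coker_proj (covering_map X) x) =
  coker_proj (covering_map X') (laurent_map g x).
Proof. exact: (coker_mapE (covering_mapP g)). Qed.

HB.instance Definition _ (X X' : seifert A) (g : seifert_hom X X') :=
  GRing.isLinear.Build {laurent A} (covering X) (covering X') *:%R
    (covering_hom g) (coker_map_linear (covering_mapP g)).

End Covering.

Section CoveringFunctor.
Context {A : pzRingType}.
Context (covP : forall X : seifert A, is_blanchfield (covering X)).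

Definition covering_functor (X : seifert_category A) : blanchfield_category A :=
  Blanchfield (covP X).

Definition covering_functor_hom (X X' : seifert_category A) (g : mor X X') :
    mor (covering_functor X) (covering_functor X') :=
  covering_hom (g : seifert_hom X X').
End CoveringFunctor.

Section BlanchfieldZ.
Context {A : pzRingType}.

Definition blanchfield_z (B : blanchfield_category A) : mor B B :=
  zmap (B : blanchfield A).
Definition blanchfield_zinv (B : blanchfield_category A) : mor B B :=
  zinvmap (B : blanchfield A).
End BlanchfieldZ.

(* Main.v *)
Require Import Defs.
From HB Require Import structures.
From mathcomp Require Import all_boot all_algebra.
From mathcomp Require Import finmap boolp monalg zify.

Set Implicit Arguments.
Unset Strict Implicit.
Unset Printing Implicit Defensive.

Import GRing.Theory.

Local Open Scope ring_scope.
Local Open Scope cat_scope.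

(** Write w = 1 - z, and for a Seifert module (P, e) put s = e (1 - e) and
    d = 1 - e + z e = 1 - w e, so that B(P, e) = coker d.

    Comparing coefficients in d u = x gives (1 - e) u_k + e u_(k-1) = x_k.  As
    u has finite support, u_k is killed by a power of 1 - e if x vanishes in
    degrees <= k, and by a power of e if x vanishes in degrees > k
    ([covering_map_low], [covering_map_high]).  Since 1 - e and e generate the
    unit ideal of Z[e], d is injective.  The same argument shows that a constant
    v in P which dies in B(P, e) is killed by a power of s.  On B(P, e) the
    relation d = 0 reads w e = 1, and z^-1 d = 0 reads (1 - z^-1)(1 - e) = 1; so
    B(e) and B(1 - e) are inverse to 1 - z and 1 - z^-1, and B(P, e) is a
    Blanchfield module.  Moreover z s = - (1 - e)^2 and z^-1 s = - e^2 on
    constants, so every element of B(P, e) becomes a constant after applying a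
    power of B(s): B(P, e) is the localisation of P at s.

    Full and faithful up to s.  A linear map f between coverings commutes with
    the inverses of 1 - z and 1 - z^-1, hence with B(e) and B(s).  As P is
    finitely generated projective, a dual basis lifts B(s)^k f, for k large, to
    an A-linear map on constants, which commutes with e after multiplication by
    a further power of s ([covering_hom_full]).  A morphism g has B(g) = 0 if
    and only if g s^l = 0 for some l ([covering_hom_eq0P]).

    Every Blanchfield module is a covering.  Given a resolution with map
    d : P1[z,z^-1] -> P0[z,z^-1], bijectivity of 1 - z on the cokernel makes
    d(1) : P1 -> P0 an isomorphism, so that one may take P1 = P0 = P and
    d(1) = 1.  Up to a power of z, d is a polynomial in z, hence in w, and it
    has the form 1 + w g + w^2 q.  By Higman's linearisation trick the cokernel is
    unchanged when P is replaced by P + P and d by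
    1 + w [[g, q], [-1, 0]], which has smaller degree in w
    ([higman_kernel]).  Iterating leads to 1 + w g = 1 - w e with e = - g.

    The Blanchfield category is additive because an additive functor that is
    surjective on isomorphism classes carries zero objects and biproducts over
    ([additive_category_transfer]). *)

(** * Linear maps and their iterates *)

Lemma linear_bijective_inverse (R : pzRingType) (U V : lmodType R)
    (f : {linear U -> V}) :
  injective f -> (forall y, exists x, f x = y) ->
  exists g : {linear V -> U}, cancel f g /\ cancel g f.
Proof.
move=> fI fS; pose g y := projT1 (cid (fS y)).
have gK : cancel g f by move=> y; rewrite /g; case: cid.
have fK : cancel f g by move=> x; apply: fI; rewrite gK.
have gl : linear g by move=> a x y; apply: fI; rewrite linearP !gK.
pose gL : {linear V -> U} := HB.pack g (GRing.isLinear.Build R V U *:%R g gl).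
by exists gL.
Qed.

Lemma sum_linearE (R : pzRingType) (U V : lmodType R) (I : Type) (r : seq I)
    (F : I -> {linear U -> V}) x :
  (\sum_(i <- r) F i) x = \sum_(i <- r) F i x.
Proof.
elim: r => [|i r IH]; first by rewrite !big_nil.
by rewrite !big_cons linear_addE IH.
Qed.

(** A linear map commutes with inverses of the multiplication by a
    fixed scalar. *)
Lemma inverse_scale_natural (R : pzRingType) (M N : lmodType R) (a : R)
    (S : {linear M -> M}) (T : {linear N -> N}) (F : {linear M -> N}) :
  (forall x, a *: S x = x) -> (forall y, a *: T y = y) ->
  forall x, F (S x) = T (F x).
Proof.
by move=> aS aT x; rewrite -[LHS]aT -linearZ -linearZ aS.
Qed.

Lemma iterC (T : Type) (f g : T -> T) n x :
  (forall y, f (g y) = g (f y)) -> iter n f (g x) = g (iter n f x).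
Proof. by move=> gh; elim: n => //= n ->. Qed.

Lemma iter_linear0 (R : pzRingType) (V : lmodType R) (f : {linear V -> V}) n :
  iter n f 0 = 0.
Proof. by elim: n => //= n ->; rewrite raddf0. Qed.

Lemma iter_linearD (R : pzRingType) (V : lmodType R) (f : {linear V -> V}) n :
  {morph iter n f : x y / x + y}.
Proof. by elim: n => //= n IH x y; rewrite /= IH linearD. Qed.

Lemma iter_linearZ (R : pzRingType) (V : lmodType R) (f : {linear V -> V}) n a :
  {morph iter n f : x / a *: x}.
Proof. by elim: n => //= n IH x; rewrite /= IH linearZ. Qed.

Lemma iter_linear_eq0 (R : pzRingType) (V : lmodType R) (f : {linear V -> V})
  m n x : (m <= n)%N -> iter m f x = 0 -> iter n f x = 0.
Proof. by move=> /subnK <-; rewrite iterD => ->; rewrite iter_linear0. Qed.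

Lemma iter_linear (R : pzRingType) (V : lmodType R) (T : {linear V -> V}) n :
  exists h : {linear V -> V}, h =1 iter n T.
Proof.
elim: n => [|n [h hE]]; first by exists (linear_id V).
by exists (linear_comp T h) => x; rewrite /= hE.
Qed.

(** * Cokernels, products and finitely generated projective modules *)

Section CokerLift.
Context {R : pzRingType} {U V W : lmodType R}.
Context (d : {linear U -> V}) (p : {linear V -> W}).
Local Open Scope quotient_scope.

(** The map out of coker d induced by a map p with p d = 0. *)
Definition coker_lift of (forall x, p (d x) = 0) := fun q : coker d =>
  p (repr (q : Quotient.quot (in_image d))).

Context (pd : forall x, p (d x) = 0).

Lemma coker_liftE x : coker_lift pd (coker_proj d x) = p x.
Proof.
rewrite /coker_lift; set y := repr _.
have /coker_projP[u du] : coker_proj d y = coker_proj d x by exact: reprK.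
by have /esym/eqP := congr1 p du; rewrite pd raddfB subr_eq0 => /eqP.
Qed.

Fact coker_lift_linear : linear (coker_lift pd).
Proof.
move=> a q r; have [x <-] := coker_proj_surj q.
have [y <-] := coker_proj_surj r.
by rewrite -linearP !coker_liftE linearP.
Qed.
HB.instance Definition _ :=
  GRing.isLinear.Build R (coker d) W *:%R (coker_lift pd) coker_lift_linear.
End CokerLift.

Section Prod.
Context {R : pzRingType} (U V : lmodType R).
(** The canonical injections into a product of two modules. *)
Definition inj1 (x : U) : U * V := (x, 0).
Definition inj2 (y : V) : U * V := (0, y).
Fact inj1_linear : linear inj1.
Proof.
by move=> a x y; apply: injective_projections; rewrite //= scaler0 addr0.
Qed.
Fact inj2_linear : linear inj2.
Proof.
by move=> a x y; apply: injective_projections; rewrite //= scaler0 addr0.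
Qed.
HB.instance Definition _ :=
  GRing.isLinear.Build R U (U * V)%type *:%R inj1 inj1_linear.
HB.instance Definition _ :=
  GRing.isLinear.Build R V (U * V)%type *:%R inj2 inj2_linear.

Lemma fg_projective_prod : fg_projective U -> fg_projective V ->
  fg_projective (U * V)%type.
Proof.
move=> [[n [s sP]] prU] [[m [r rP]] prV]; split.
  exists (n + m)%N, (fun i => match split i with
    | inl j => inj1 (s j) | inr k => inj2 (r k) end) => -[x y].
  have [a xE] := sP x; have [b yE] := rP y.
  exists (fun i => match split i with inl j => a j | inr k => b k end).
  rewrite big_split_ord /=.
  have sl i : split (lshift m i) = inl i := unsplitK (inl i).
  have sr i : split (rshift n i) = inr i := unsplitK (inr i).
  under eq_bigr => i _ do rewrite sl.
  under [X in _ + X]eq_bigr => i _ do rewrite sr.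
  apply: injective_projections; rewrite /= !raddf_sum /=.
    by rewrite xE [X in _ + X]big1 ?addr0 // => i _; rewrite scaler0.
  by rewrite yE [X in X + _]big1 ?add0r // => i _; rewrite scaler0.
move=> M N p f pS.
have [h hP] := prU M N p (linear_comp f (inj1 : {linear _ -> _})) pS.
have [k kP] := prV M N p (linear_comp f (inj2 : {linear _ -> _})) pS.
exists (linear_comp h (fst : {linear (U * V)%type -> U})
  + linear_comp k (snd : {linear (U * V)%type -> V})) => -[x y].
rewrite linear_addE raddfD /= hP kP /= -raddfD; congr (f _).
by apply: injective_projections; rewrite /= ?addr0 ?add0r.
Qed.
End Prod.

Section RowComb.
Context {R : pzRingType} {M : lmodType R} (n : nat) (s : 'I_n -> M).
(** The linear combination of the family s with a row of coefficients. *)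
Definition row_comb (a : 'rV[R]_n) : M := \sum_i a 0 i *: s i.
Fact row_comb_linear : linear row_comb.
Proof.
move=> c a b; rewrite /row_comb scaler_sumr -big_split /=.
by apply: eq_bigr => i _; rewrite !mxE scalerDl scalerA.
Qed.
HB.instance Definition _ :=
  GRing.isLinear.Build R 'rV[R]_n M *:%R row_comb row_comb_linear.
End RowComb.

Section Form.
Context {R : pzRingType} {P M : lmodType R} (n : nat).
Context (h : {linear P -> 'rV[R]_n}).
(** The map v |-> h_i(v) m, where h_i is the i-th coordinate of h. *)
Definition rank_one (i : 'I_n) (m : M) (v : P) : M := h v 0 i *: m.
Fact rank_one_linear i m : linear (rank_one i m).
Proof. by move=> c a b; rewrite /rank_one linearP !mxE scalerDl scalerA. Qed.
HB.instance Definition _ i m :=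
  GRing.isLinear.Build R P M *:%R (rank_one i m) (rank_one_linear i m).
End Form.

(** The coordinates of h are the linear forms dual to the generators s. *)
Lemma dual_basis (R : pzRingType) (P : lmodType R) : fg_projective P ->
  exists (n : nat) (s : 'I_n -> P) (h : {linear P -> 'rV[R]_n}),
    forall v, v = \sum_i h v 0 i *: s i.
Proof.
move=> [[n [s sP]] pr]; exists n, s.
have [|h hP] := pr 'rV[R]_n P (row_comb s) (linear_id P).
  move=> y; have [a ->] := sP y; exists (\row_i a i).
  by apply: eq_bigr => i _; rewrite mxE.
by exists h => v; rewrite -[LHS]/(linear_id P v) -hP.
Qed.

(** On a finitely generated module, pointwise vanishing of iterates is
    uniform. *)
Lemma uniform_nilpotent (R : pzRingType) (P V : lmodType R)
    (T : {linear V -> V}) (h : {linear P -> V}) : finitely_generated P ->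
  (forall v, exists n, iter n T (h v) = 0) ->
  exists n, forall v, iter n T (h v) = 0.
Proof.
move=> [m [s sP]] hN; pose N i := projT1 (cid (hN (s i))).
have NP i : iter (N i) T (h (s i)) = 0 by rewrite /N; case: cid.
exists (\max_i N i)%N => v; have [a ->] := sP v.
rewrite linear_sum.
apply: (big_ind (fun x => iter _ T x = 0)) => [|x y xE yE|i _].
- exact: iter_linear0.
- by rewrite iter_linearD xE yE addr0.
rewrite linearZ iter_linearZ (iter_linear_eq0 _ (NP i)) ?scaler0 //.
exact: leq_bigmax.
Qed.

(** * Laurent extensions *)

Lemma zmonomE (A : pzRingType) (P : lmodType A) k (v : P) :
  zmonom k v = zpow k *: zmonom 0 v.
Proof. by rewrite laurent_scaleE addr0 scale1r. Qed.

Lemma zmonomZ (A : pzRingType) (P : lmodType A) k (a : A) (v : P) :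
  zmonom k (a *: v) = zmonom 0 a *: zmonom k v.
Proof. by rewrite laurent_scaleE add0r. Qed.

Lemma zpowD (A : pzRingType) i j :
  zpow (i + j) = zpow i * zpow j :> {laurent A}.
Proof. by rewrite laurent_mulE mulr1. Qed.

Lemma zpow0 (A : pzRingType) : zpow 0 = 1 :> {laurent A}.
Proof. by []. Qed.

Lemma zpowNK (A : pzRingType) (M : lmodType {laurent A}) k (x : M) :
  zpow (- k) *: (zpow k *: x) = x.
Proof. by rewrite scalerA -zpowD addNr zpow0 scale1r. Qed.

Lemma zpowKN (A : pzRingType) (M : lmodType {laurent A}) k (x : M) :
  zpow k *: (zpow (- k) *: x) = x.
Proof. by rewrite scalerA -zpowD subrr zpow0 scale1r. Qed.

Lemma linear_laurent_eq (A : pzRingType) (P : lmodType A)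
    (M : lmodType {laurent A}) (f g : {linear {laurent P} -> M}) :
  (forall v, f (zmonom 0 v) = g (zmonom 0 v)) -> f =1 g.
Proof.
move=> fg; elim/laurent_ind => [k v|x y xE yE]; last by rewrite !linearD xE yE.
by rewrite zmonomE !linearZ fg.
Qed.

Lemma coeff_zpow (A : pzRingType) (P : lmodType A) i k (x : {laurent P}) :
  (zpow i *: x)@_k = x@_(k - i).
Proof.
elim/laurent_ind: x => [j v|x y xE yE].
  rewrite laurent_scaleE scale1r !mcoeffU; congr (_ *+ nat_of_bool _).
  lia.
by rewrite scalerDr !mcoeffD xE yE.
Qed.

Lemma coeff_bounded (P : zmodType) (x : {laurent P}) :
  exists N : nat, forall k : int, (N < `|k|)%N -> x@_k = 0.
Proof.
elim/laurent_ind: x => [j v|x y [N Nx] [L Ly]].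
  exists `|j|%N => k jk; rewrite mcoeffU; case: eqP => [jkE|_] //.
  by rewrite jkE ltnn in jk.
exists (maxn N L) => k; rewrite gtn_max => /andP[Nk Lk].
by rewrite mcoeffD Nx ?Ly ?addr0.
Qed.

Section OneMinusZ.
Context {A : pzRingType}.

(** Multiplication by w = 1 - z. *)
Definition wmap (M : lmodType {laurent A}) : {linear M -> M} :=
  linear_id M - zmap M.

Lemma wmapE (M : lmodType {laurent A}) x : wmap M x = x - zpow 1 *: x.
Proof. by []. Qed.

Lemma wmap_natural (M N : lmodType {laurent A}) (f : {linear M -> N}) x :
  f (wmap M x) = wmap N (f x).
Proof. by rewrite !linear_subE linearB /= /zscale linearZ. Qed.
End OneMinusZ.

Section LaurentMapTheory.
Context {A : pzRingType} {U V : lmodType A} (f : {linear U -> V}).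

Lemma laurent_mapD : {morph laurent_map f : x y / x + y}.
Proof. exact: linearD. Qed.
Lemma laurent_map_wmap x : laurent_map f (wmap _ x) = wmap _ (laurent_map f x).
Proof. exact: wmap_natural. Qed.
End LaurentMapTheory.

Section LaurentMapFun.
Context {A : pzRingType}.

Lemma laurent_mapD_fun (U V : lmodType A) (f g : {linear U -> V}) x :
  laurent_map (f + g) x = laurent_map f x + laurent_map g x.
Proof. by apply: laurent_eq => k; rewrite mcoeffD !coeff_laurent_map. Qed.

Lemma laurent_mapN_fun (U V : lmodType A) (f : {linear U -> V}) x :
  laurent_map (- f) x = - laurent_map f x.
Proof. by apply: laurent_eq => k; rewrite mcoeffN !coeff_laurent_map. Qed.

Lemma laurent_map0_fun {U V : lmodType A} x :
  laurent_map (0 : {linear U -> V}) x = 0.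
Proof. by apply: laurent_eq => k; rewrite mcoeff0 coeff_laurent_map. Qed.

Lemma laurent_map_comp (U V W : lmodType A) (f : {linear V -> W})
    (g : {linear U -> V}) x :
  laurent_map f (laurent_map g x) = laurent_map (linear_comp f g) x.
Proof. by apply: laurent_eq => k; rewrite !coeff_laurent_map. Qed.

Lemma laurent_map_ext (U V : lmodType A) (f g : {linear U -> V}) x :
  f =1 g -> laurent_map f x = laurent_map g x.
Proof. by move=> fg; apply: laurent_eq => k; rewrite !coeff_laurent_map fg. Qed.

Lemma laurent_map_id (U : lmodType A) (f : {linear U -> U}) x :
  f =1 id -> laurent_map f x = x.
Proof. by move=> fE; apply: laurent_eq => k; rewrite coeff_laurent_map fE. Qed.
End LaurentMapFun.

(** * Injectivity of the covering map *)

Section CoveringBasics.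
Context {A : pzRingType}.
Implicit Types X : seifert A.

(** The endomorphisms 1 - e and s = e (1 - e) of a Seifert module. *)
Definition coendo X : {linear X -> X} := linear_id X - seifert_endo X.
Definition sendo X : {linear X -> X} := linear_comp (seifert_endo X) (coendo X).
Local Notation e := (seifert_endo _).
Local Notation c := (coendo _).

Lemma endo_add X (x : X) : c x + e x = x.
Proof. exact: subrK. Qed.

Lemma endoC X (x : X) : e (c x) = c (e x).
Proof. by rewrite /= raddfB. Qed.

Lemma iter_endo_coendo X n (x : X) : iter n e (c x) = c (iter n e x).
Proof. by apply: iterC => y; rewrite endoC. Qed.

Lemma iter_coendo_endo X n (x : X) : iter n c (e x) = e (iter n c x).
Proof. by apply: iterC => y; rewrite endoC. Qed.

Lemma iter_sendo X n (x : X) :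
  iter n (sendo X) x = iter n e (iter n c x).
Proof.
elim: n x => // n IH x; rewrite iterSr IH [in RHS]iterSr [in RHS]iterSr.
rewrite -[sendo X x]/(e (c x)); congr (iter n _ _).
by apply: iterC => y; rewrite endoC.
Qed.

Lemma iter_endo_coendoC X m n (x : X) :
  iter m e (iter n c x) = iter n c (iter m e x).
Proof. by apply: iterC => y; rewrite iter_coendo_endo. Qed.

(** Powers of e and 1 - e are comaximal; induction on the two exponents replaces
    the explicit Bezout relation, since e x and (1 - e) x have a smaller one. *)
Lemma endo_coendo_nilpotent X m n (x : X) :
  iter m e x = 0 -> iter n c x = 0 -> x = 0.
Proof.
elim: m n x => [//|m IHm] n x em.
elim: n x em => [//|n IHn] x em cn.
rewrite -[x]endo_add (IHn (c x)) ?add0r -?iterSr //; last first.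
  by rewrite iter_endo_coendo em linear0.
apply: (IHm n.+1); first by rewrite -iterSr.
by rewrite iter_coendo_endo cn linear0.
Qed.

Lemma coeff_covering_map X (u : {laurent X}) k :
  (covering_map X u)@_k = c u@_k + e u@_(k - 1).
Proof.
by rewrite covering_mapE mcoeffD mcoeffB coeff_zpow !coeff_laurent_map.
Qed.

(** Below the support of u all coefficients vanish; then
    (1 - e) u_k = - e u_(k-1) costs one more power of 1 - e for each degree. *)
Lemma covering_map_low X (u : {laurent X}) (m : int) :
  (forall k, k <= m -> (covering_map X u)@_k = 0) ->
  exists n, iter n c u@_m = 0.
Proof.
move=> du; have [N uN] := coeff_bounded u.
have kill n : forall k : int, k <= m -> k < - N%:Z + n%:Z -> iter n c u@_k = 0.
  elim: n => [|n IH] k km kN.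
    by apply: uN; rewrite -ltz_nat; lia.
  have /eqP := du k km; rewrite coeff_covering_map addrC addr_eq0 => /eqP cu.
  have -> : iter n.+1 c u@_k = iter n c (c u@_k) by rewrite iterSr.
  have -> : c u@_k = - e u@_(k - 1) by rewrite cu opprK.
  rewrite -scaleN1r iter_linearZ iter_coendo_endo IH ?linear0 ?scaler0 //; lia.
exists (`|m| + N).+1; apply: kill; lia.
Qed.

(** Dual to [covering_map_low], descending from above the support of u. *)
Lemma covering_map_high X (u : {laurent X}) (m : int) :
  (forall k, m < k -> (covering_map X u)@_k = 0) ->
  exists n, iter n e u@_m = 0.
Proof.
move=> du; have [N uN] := coeff_bounded u.
have kill n : forall k : int, m <= k -> N%:Z < k + n%:Z -> iter n e u@_k = 0.
  elim: n => [|n IH] k km kN.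
    by apply: uN; rewrite -ltz_nat; lia.
  have /eqP := du (k + 1) ltac:(lia).
  rewrite coeff_covering_map addrK addr_eq0 => /eqP cu.
  have -> : iter n.+1 e u@_k = iter n e (e u@_k) by rewrite iterSr.
  have -> : e u@_k = - c u@_(k + 1) by rewrite cu opprK.
  rewrite -scaleN1r iter_linearZ iter_endo_coendo IH ?linear0 ?scaler0 //; lia.
exists (`|m| + N).+1; apply: kill; lia.
Qed.

Lemma covering_map_inj X : injective (covering_map X).
Proof.
apply: raddf_inj => u du; apply: laurent_eq => k.
have [m mk] : exists n, iter n e u@_k = 0.
  by apply: covering_map_high => j _; rewrite du mcoeff0.
have [n nk] : exists n, iter n c u@_k = 0.
  by apply: covering_map_low => j _; rewrite du mcoeff0.
by rewrite mcoeff0; apply: endo_coendo_nilpotent mk nk.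
Qed.

(** If d u = v then v = (1 - e) u_0 + e u_(-1), where a power of e kills u_0
    and a power of 1 - e kills u_(-1). *)
Lemma covering_map_monom_nilpotent X (v : X) u :
  covering_map X u = zmonom 0 v ->
  exists n, iter n (sendo X) v = 0.
Proof.
move=> du.
have [m m0] : exists n, iter n e u@_0 = 0.
  apply: covering_map_high => j j0; rewrite du mcoeffU; case: eqP => // jE; lia.
have [n n1] : exists n, iter n c u@_(-1) = 0.
  apply: covering_map_low => j j0; rewrite du mcoeffU; case: eqP => // jE; lia.
exists (maxn m n).
have /esym := coeff_covering_map u 0.
rewrite du mcoeffUU => <-; rewrite sub0r iter_linearD !iter_sendo.
have k1 := iter_linear_eq0 (leq_maxr m n) n1.
have k2 := iter_linear_eq0 (leq_maxl m n) m0.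
rewrite iter_coendo_endo k1 linear0 iter_linear0 addr0.
by rewrite iter_endo_coendoC iter_endo_coendo k2 linear0 iter_linear0.
Qed.
End CoveringBasics.

(** * Coverings as localisations at e (1 - e) *)

Section CoveringConst.
Context {A : pzRingType}.
Implicit Types X : seifert A.
Local Notation e := (seifert_endo _).
Local Notation c := (coendo _).

(** The class in B(P, e) of a constant v in P. *)
Definition const_class X (v : X) : covering X :=
  coker_proj (covering_map X) (zmonom 0 v).

Lemma const_classD X : {morph @const_class X : v w / v + w}.
Proof. by move=> v w; rewrite /const_class !raddfD. Qed.

Lemma const_classN X : {morph @const_class X : v / - v}.
Proof. by move=> v; rewrite /const_class !raddfN. Qed.

Lemma const_classZ X a :
  {morph @const_class X : v / a *: v >-> zmonom 0 a *: v}.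
Proof. by move=> v; rewrite /const_class zmonomZ linearZ. Qed.

Lemma const_class_sum X (I : Type) (r : seq I) (F : I -> X) :
  const_class (\sum_(i <- r) F i) = \sum_(i <- r) const_class (F i).
Proof.
elim: r => [|i r IH]; last by rewrite !big_cons const_classD IH.
by rewrite !big_nil /const_class !raddf0.
Qed.

Lemma const_class_eq0 X (v : X) :
  const_class v = 0 -> exists n, iter n (sendo X) v = 0.
Proof.
move=> v0.
have : const_class v = coker_proj (covering_map X) 0 by rewrite v0 raddf0.
by case/coker_projP => u; rewrite subr0 => /covering_map_monom_nilpotent.
Qed.

Lemma covering_hom_const X X' (g : seifert_hom X X') v :
  covering_hom g (const_class v) = const_class (g v).
Proof. by rewrite covering_homE laurent_map_monom. Qed.

(** Constants generate the covering over A[z,z^-1]. *)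
Lemma covering_hom_eq X (M : lmodType {laurent A})
    (f g : {linear covering X -> M}) :
  (forall v, f (const_class v) = g (const_class v)) -> f =1 g.
Proof.
move=> fg q; have [x <-] := coker_proj_surj q.
elim/laurent_ind: x => [k v|x y xE yE].
  by rewrite zmonomE !linearZ; congr (_ *: _); exact: fg.
by rewrite linearD !linearD xE yE.
Qed.

(** The relation d = 0: z e = - (1 - e) on constants. *)
Lemma const_class_rel X (v : X) :
  zpow 1 *: const_class (e v) = - const_class (c v).
Proof.
apply/eqP; rewrite -addr_eq0 -[_ *: _]linearZ -raddfD; apply/eqP.
rewrite -(raddf0 (coker_proj (covering_map X))); apply/coker_projP.
exists (zmonom 0 v); rewrite subr0 covering_mapE laurent_map_monom addrC.
by congr (_ + _); rewrite -raddfB.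
Qed.

Lemma const_class_relN X (v : X) :
  zpow (- 1) *: const_class (c v) = - const_class (e v).
Proof.
by rewrite -[const_class (c v)]opprK -const_class_rel scalerN zpowNK.
Qed.

Lemma scale_1Bz_const X (v : X) :
  (1 - zpow 1) *: const_class (e v) = const_class v.
Proof.
rewrite scalerBl scale1r const_class_rel opprK -const_classD addrC.
by rewrite endo_add.
Qed.

Lemma scale_1Bzinv_const X (v : X) :
  (1 - zpow (- 1)) *: const_class (c v) = const_class v.
Proof.
by rewrite scalerBl scale1r const_class_relN opprK -const_classD endo_add.
Qed.

(** The endomorphisms e, 1 - e and s in the Seifert category. *)
Definition endo_hom X : seifert_hom X X := @seifert_self A X.
Definition coendo_hom X : seifert_hom X X := seifert_id X - endo_hom X.
Definition sendo_hom X : seifert_hom X X :=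
  seifert_comp (endo_hom X) (coendo_hom X).

Section Sendo.
Context (X : seifert A).
Local Notation T := (covering_hom (sendo_hom X)).

(** Every element of a covering becomes a constant after applying a power of
    B(s), because z s = - (1 - e)^2 and z^-1 s = - e^2 on constants. *)
Lemma covering_sendo_const (x : covering X) :
  exists k v, iter k T x = const_class v.
Proof.
have Tv n v : iter n T (const_class v) = const_class (iter n (sendo X) v).
  by elim: n => //= n ->; rewrite covering_hom_const.
have step1 (y : covering X) : (exists k v, iter k T y = const_class v) ->
    exists k v, iter k T (zpow 1 *: y) = const_class v.
  move=> [k [v yv]]; exists k.+1, (- c (c v)).
  rewrite iter_linearZ -[iter _ _ _]/(T (iter k T y)) yv covering_hom_const.
  by rewrite -[sendo_hom X v]/(e (c v)) const_class_rel const_classN.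
have stepN (y : covering X) : (exists k v, iter k T y = const_class v) ->
    exists k v, iter k T (zpow (- 1) *: y) = const_class v.
  move=> [k [v yv]]; exists k.+1, (- e (e v)).
  rewrite iter_linearZ -[iter _ _ _]/(T (iter k T y)) yv covering_hom_const.
  rewrite -[sendo_hom X v]/(e (c v)) endoC const_class_relN.
  by rewrite const_classN.
have [u <-] := coker_proj_surj x; elim/laurent_ind: u => [k v|y w].
  rewrite zmonomE linearZ /= -/(const_class v).
  case: k => n.
    elim: n => [|n IH]; first by exists 0%N, v; rewrite zpow0 scale1r.
    by rewrite -addn1 PoszD addrC zpowD -scalerA; apply: step1.
  rewrite NegzE; elim: n => [|n IH].
    by apply: stepN; exists 0%N, v.
  by rewrite -addn1 PoszD opprD addrC zpowD -scalerA; apply: stepN.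
move=> [k [v yv]] [l [v' wv']].
exists (l + k)%N, (iter l (sendo X) v + iter k (sendo X) v').
rewrite raddfD iter_linearD {1}iterD yv addnC iterD wv' !Tv.
by rewrite const_classD.
Qed.
End Sendo.

(** * Morphisms between coverings *)

Lemma covering_endo_inv X (x : covering X) :
  (1 - zpow 1) *: covering_hom (endo_hom X) x = x.
Proof.
pose h := linear_comp (linear_id _ - zmap (covering X))
  (covering_hom (endo_hom X) : {linear covering X -> covering X}).
have hE y : h y = (1 - zpow 1) *: covering_hom (endo_hom X) y.
  by rewrite scalerBl scale1r.
rewrite -[LHS]hE; apply: (@covering_hom_eq _ _ h (linear_id _)) => v.
by rewrite hE covering_hom_const; exact: scale_1Bz_const.
Qed.

Lemma covering_coendo_inv X (x : covering X) :
  (1 - zpow (- 1)) *: covering_hom (coendo_hom X) x = x.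
Proof.
pose h := linear_comp (linear_id _ - zinvmap (covering X))
  (covering_hom (coendo_hom X) : {linear covering X -> covering X}).
have hE y : h y = (1 - zpow (- 1)) *: covering_hom (coendo_hom X) y.
  by rewrite scalerBl scale1r.
rewrite -[LHS]hE; apply: (@covering_hom_eq _ _ h (linear_id _)) => v.
by rewrite hE covering_hom_const; exact: scale_1Bzinv_const.
Qed.

Lemma covering_sendo_inv X (x : covering X) :
  (1 - zpow 1) *: ((1 - zpow (- 1)) *: covering_hom (sendo_hom X) x) = x.
Proof.
have -> : covering_hom (sendo_hom X) x =
    covering_hom (endo_hom X) (covering_hom (coendo_hom X) x).
  apply: (@covering_hom_eq _ _ (covering_hom (sendo_hom X)) (linear_comp
    (covering_hom (endo_hom X)) (covering_hom (coendo_hom X)))) => v.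
  by rewrite /= !covering_hom_const.
have zE y : (1 - zpow (- 1)) *: covering_hom (endo_hom X) y =
    covering_hom (endo_hom X) ((1 - zpow (- 1)) *: y) by rewrite linearZ.
by rewrite zE covering_coendo_inv covering_endo_inv.
Qed.

Lemma covering_hom_eq0P X X' (g : seifert_hom X X') :
  (forall x, covering_hom g x = 0) <->
  exists l, forall v, g (iter l (sendo X) v) = 0.
Proof.
have gs l v : g (iter l (sendo X) v) = iter l (sendo X') (g v).
  have gs w : g (sendo X w) = sendo X' (g w).
    rewrite -[sendo X w]/(e (w - e w)) -seifert_mapP linearB.
    by rewrite -seifert_mapP.
  by elim: l => //= l <-; rewrite gs.
split=> [g0|[l gl] x].
  have [l gl] : exists l, forall v, iter l (sendo X') (g v) = 0.
    apply: uniform_nilpotent; first by case: (seifert_fgp X).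
    by move=> v; apply: const_class_eq0; rewrite -covering_hom_const g0.
  by exists l => v; rewrite gs gl.
pose sX := sendo_hom X.
(* B(g) B(s)^l = B(g s^l) = 0, and B(s) is invertible with inverse u. *)
pose u : {laurent A} := (1 - zpow 1) * (1 - zpow (- 1)).
have uT (y : covering X) : u *: covering_hom sX y = y.
  by rewrite -scalerA covering_sendo_inv.
suff -> : x = iter l (fun y => u *: y) (iter l (covering_hom sX) x).
  have -> n y : covering_hom g (iter n (fun y => u *: y) y) =
      iter n (fun y => u *: y) (covering_hom g y).
    by elim: n => //= n <-; rewrite linearZ.
  have [h hE] := iter_linear (covering_hom sX : {linear _ -> _}) l.
  have gh0 y : covering_hom g (h y) = 0.
    apply: (@covering_hom_eq _ _ (linear_comp (covering_hom g) h) 0) => v.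
    rewrite /= hE; have -> : iter l (covering_hom sX) (const_class v) =
        const_class (iter l (sendo X) v).
      by elim: (l) => //= n ->; rewrite covering_hom_const.
    by rewrite covering_hom_const gl /const_class !raddf0.
  by rewrite -hE gh0; elim: (l) => //= n ->; rewrite scaler0.
elim: l {gl} => // l IH; rewrite iterSr [iter l.+1 (covering_hom _) x]iterS.
by rewrite uT.
Qed.

Lemma covering_hom_full X X' (f : {linear covering X -> covering X'}) :
  exists (g : seifert_hom X X') k,
    forall x, f (iter k (covering_hom (sendo_hom X)) x) = covering_hom g x.
Proof.
pose T := (covering_hom (sendo_hom X) : {linear _ -> _}).
pose T' := (covering_hom (sendo_hom X') : {linear _ -> _}).
have T'i k v : iter k T' (const_class v) = const_class (iter k (sendo X') v).
  by elim: k => //= k ->; rewrite covering_hom_const.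
have [n [s [h hP]]] := dual_basis (seifert_fgp X).
have kwX j : exists p : nat * X',
    iter p.1 T' (f (const_class (s j))) = const_class p.2.
  have [k [v kv]] := covering_sendo_const (f (const_class (s j))).
  by exists (k, v).
pose kw j := projT1 (cid (kwX j)).
have kwP j : iter (kw j).1 T' (f (const_class (s j))) = const_class (kw j).2.
  by rewrite /kw; case: cid.
(* A common exponent K for the generators s_j, with B(s)^K f(s_j) = w_j. *)
pose K := (\max_j (kw j).1)%N.
pose w j := iter (K - (kw j).1) (sendo X') (kw j).2.
have wP j : iter K T' (f (const_class (s j))) = const_class (w j).
  have jK : ((kw j).1 <= K)%N by exact: (leq_bigmax (F := fun j => (kw j).1)).
  by rewrite -{1}(subnK jK) iterD kwP T'i.
(* The dual basis gives a lift g0 of B(s)^K f to constants.  It need not commute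
   with e, but B sees no difference, so it does after applying s^l. *)
pose g0 := linear_comp (row_comb w) h.
have g0P v : const_class (g0 v) = iter K T' (f (const_class v)).
  have [TK TKE] := iter_linear T' K.
  rewrite {2}[v]hP !const_class_sum linear_sum -TKE linear_sum.
  apply: eq_bigr => j _; rewrite !const_classZ !linearZ TKE.
  by congr (_ *: _); rewrite wP.
pose E := (covering_hom (endo_hom X) : {linear _ -> _}).
pose E' := (covering_hom (endo_hom X') : {linear _ -> _}).
have EP := @covering_endo_inv X.
have EP' := @covering_endo_inv X'.
have fE (x : covering X) : f (E x) = E' (f x).
  exact: (inverse_scale_natural f EP EP').
have TE (x : covering X') : T' (E' x) = E' (T' x).
  exact: (inverse_scale_natural T' EP' EP').
pose dl := linear_comp (seifert_endo X') g0 - linear_comp g0 (seifert_endo X).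
have [l lP] : exists l, forall v, iter l (sendo X') (dl v) = 0.
  apply: uniform_nilpotent; first by case: (seifert_fgp X).
  move=> v; apply: const_class_eq0.
  rewrite linear_subE const_classD const_classN /=.
  rewrite -[const_class (e (g0 v))](covering_hom_const (endo_hom X')).
  rewrite [const_class (g0 v)]g0P [const_class (g0 _)]g0P.
  rewrite -[const_class (e v)](covering_hom_const (endo_hom X)).
  by rewrite -/E -/E' fE iterC // subrr.
have [sl slE] := iter_linear (sendo X') l.
have gP v : e (linear_comp sl g0 v) = linear_comp sl g0 (e v).
  have es (y : X') : e (iter l (sendo X') y) = iter l (sendo X') (e y).
    by rewrite iterC // => y'; rewrite /= !linearB.
  apply/eqP; rewrite -subr_eq0 /= !slE es -!slE -linearB slE.
  by apply/eqP; exact: lP.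
pose g := SeifertHom gP; exists g, (l + K)%N.
have fT (x : covering X) : f (T x) = T' (f x).
  apply: (@inverse_scale_natural _ _ _ ((1 - zpow 1) * (1 - zpow (- 1))) T T').
    by move=> y; rewrite -scalerA covering_sendo_inv.
  by move=> y; rewrite -scalerA covering_sendo_inv.
have [TK TKE] := iter_linear T (l + K)%N.
have gE : linear_comp f TK =1 covering_hom g.
  apply: (@covering_hom_eq _ _ _ (covering_hom g)) => v.
  rewrite -[RHS]/(covering_hom g (const_class v)) covering_hom_const.
  rewrite /g /= slE TKE -T'i [const_class (g0 v)]g0P -iterD.
  by elim: (l + K)%N => //= m <-; exact: fT.
by move=> x; rewrite -TKE -gE.
Qed.
End CoveringConst.

(** * Linear maps as polynomials in 1 - z *)

Section Wpoly.
Context {A : pzRingType}.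

Section Weval.
Context {P Q : lmodType A}.

(** The map sum_i w^i g_i, for the list of its coefficients g_i : P -> Q. *)
Fixpoint wpoly (l : seq {linear P -> Q}) :
    {linear {laurent P} -> {laurent Q}} :=
  if l is g :: l' then (laurent_map g : {linear _ -> _})
    + linear_comp (wmap _) (wpoly l') else 0.

Lemma wpoly_cons g l x :
  wpoly (g :: l) x = laurent_map g x + wmap _ (wpoly l x).
Proof. by []. Qed.

Lemma wpoly1 g x : wpoly [:: g] x = laurent_map g x.
Proof. by rewrite wpoly_cons [wpoly [::] x]/= linear0 addr0. Qed.

Lemma wpolyD l1 l2 : exists l, wpoly l = wpoly l1 + wpoly l2.
Proof.
elim: l1 l2 => [|g l1 IH] [|h l2].
- by exists [::]; rewrite addr0.
- by exists (h :: l2); rewrite add0r.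
- by exists (g :: l1); rewrite addr0.
have [l lE] := IH l2; exists (g + h :: l); apply: linear_eq => x.
rewrite wpoly_cons lE [(wpoly l1 + _) x]linear_addE laurent_mapD_fun.
by rewrite [wmap _ _]linearD linear_addE !wpoly_cons addrACA.
Qed.

Lemma wpolyN l : exists l', wpoly l' = - wpoly l.
Proof.
elim: l => [|g l [l' lE]]; first by exists [::]; rewrite oppr0.
exists (- g :: l'); apply: linear_eq => x.
rewrite wpoly_cons lE laurent_mapN_fun linear_oppE linear_oppE linearN.
by rewrite -opprD.
Qed.

(** Polynomials in w are closed under multiplication by z = 1 - w. *)
Lemma wpoly_z l : exists l', wpoly l' = linear_comp (zmap _) (wpoly l).
Proof.
have [l1 E1] := wpolyN l; have [l2 E2] := wpolyD l (0 :: l1).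
exists l2; rewrite E2; apply: linear_eq => x.
rewrite linear_addE wpoly_cons E1 laurent_map0_fun add0r linear_oppE linearN.
by rewrite [wmap _ _]linear_subE /= opprB addrCA subrr addr0.
Qed.

Lemma wpoly_zpow (n : nat) l :
  exists l', wpoly l' = linear_comp (zscale n) (wpoly l).
Proof.
elim: n => [|n [l1 E1]].
  by exists l; apply: linear_eq => x; rewrite /= /zscale zpow0 scale1r.
have [l2 E2] := wpoly_z l1; exists l2; rewrite E2 E1; apply: linear_eq => x /=.
by rewrite /zscale scalerA -zpowD.
Qed.

(** z^n f is a polynomial in w for some n. *)
Definition is_lpoly (f : {linear {laurent P} -> {laurent Q}}) :=
  exists (n : nat) l, linear_comp (zscale n) f = wpoly l.

Lemma is_lpoly0 : is_lpoly 0.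
Proof.
by exists 0%N, [::]; apply: linear_eq => x /=; rewrite /zscale scaler0.
Qed.

Lemma is_lpolyD f g : is_lpoly f -> is_lpoly g -> is_lpoly (f + g).
Proof.
move=> [n [l nl]] [m [k mk]].
have [l1 E1] := wpoly_zpow m l; have [k1 F1] := wpoly_zpow n k.
have [r rE] := wpolyD l1 k1; exists (n + m)%N, r; rewrite rE E1 F1 -nl -mk.
apply: linear_eq => x /=; rewrite /zscale scalerDr !scalerA -!zpowD.
by rewrite PoszD [in zpow (m%:Z + _)]addrC.
Qed.

Lemma is_lpoly_monom k g : is_lpoly (linear_comp (zscale k) (laurent_map g)).
Proof.
case: k => n.
  have [l lE] := wpoly_zpow n [:: g].
  exists 0%N, l; rewrite lE; apply: linear_eq => x.
  by rewrite -[RHS]/(zscale n (wpoly [:: g] x)) wpoly1 /= /zscale zpow0 scale1r.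
exists n.+1, [:: g]; apply: linear_eq => x.
by rewrite wpoly1 /= /zscale NegzE zpowKN.
Qed.

(** A linear map on P[z,z^-1] has finitely many coefficients P -> Q, because it
    is determined by its values on finitely many generators of P; so some power of
    z makes it a polynomial in z, hence in w. *)
Lemma linear_is_lpoly (d : {linear {laurent P} -> {laurent Q}}) :
  fg_projective P -> is_lpoly d.
Proof.
move=> /dual_basis[n [s [h hP]]].
pose y j := d (zmonom 0 (s j)).
have -> : d = \sum_j \sum_(k <- msupp (y j))
    linear_comp (zscale k) (laurent_map (rank_one h j (y j)@_k)).
  apply: linear_eq; apply: linear_laurent_eq => v.
  have vE : zmonom 0 v = \sum_j zmonom 0 (h v 0 j) *: zmonom 0 (s j).
    rewrite {1}[v]hP raddf_sum; apply: eq_bigr => j _; exact: zmonomZ.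
  rewrite [in LHS]vE linear_sum sum_linearE.
  apply: eq_bigr => j _; rewrite sum_linearE linearZ -/(y j).
  rewrite {1}[y j]laurent_sum; etransitivity; first exact: scaler_sumr.
  apply: eq_bigr => k _.
  by rewrite /= laurent_map_monom /zscale -zmonomE -zmonomZ.
apply: big_ind => [|f g|j _]; [exact: is_lpoly0|exact: is_lpolyD|].
apply: big_ind => [|f g|k _]; [exact: is_lpoly0|exact: is_lpolyD|].
exact: is_lpoly_monom.
Qed.
End Weval.

Section Aug.
Context {P : lmodType A}.
(** The augmentation P[z,z^-1] -> P at z = 1. *)
Definition aug : {laurent P} -> P := laurent_extend (fun=> idfun).
HB.instance Definition _ :=
  GRing.Additive.copy aug (laurent_extend (fun=> idfun)).

Lemma augD : {morph aug : x y / x + y}.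
Proof. exact: raddfD. Qed.

Lemma augB : {morph aug : x y / x - y}.
Proof. exact: raddfB. Qed.

Lemma aug_monom k v : aug (zmonom k v) = v.
Proof. exact: laurent_extendE. Qed.

Lemma aug_scale k a x : aug (zmonom k a *: x) = a *: aug x.
Proof.
elim/laurent_ind: x => [i v|x y xE yE].
  by rewrite laurent_scaleE !aug_monom.
by rewrite scalerDr !augD xE yE scalerDr.
Qed.

Lemma aug_zpow k x : aug (zpow k *: x) = aug x.
Proof. by rewrite aug_scale scale1r. Qed.

Lemma aug_wmap x : aug (wmap _ x) = 0.
Proof. by rewrite linear_subE augB /= aug_zpow subrr. Qed.

(** Modulo the image of 1 - z, every element is a constant. *)
Lemma wmap_aug x : exists y, x = zmonom 0 (aug x) + wmap _ y.
Proof.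
elim/laurent_ind: x => [k v|x1 x2 [y1 E1] [y2 E2]]; last first.
  by exists (y1 + y2); rewrite {1}E1 {1}E2 addrACA augD !raddfD.
rewrite aug_monom.
have step (j : int) :
    exists y : {laurent P}, zmonom (j + 1) v = zmonom j v + wmap _ y.
  exists (- zmonom j v); rewrite linearN wmapE opprB addrCA subrr addr0.
  by rewrite laurent_scaleE scale1r addrC.
elim/int_rec: k => [|n [y yE]|n [y yE]].
- by exists 0; rewrite linear0 addr0.
- have [x xE] := step n%:Z; exists (y + x).
  by rewrite -addn1 PoszD xE yE linearD; exact/esym/addrA.
have [x xE] := step (- n.+1%:Z); exists (y - x).
have nE : - n.+1%:Z + 1 = - n%:Z by lia.
rewrite nE yE in xE.
rewrite linearB; apply: (addIr (wmap {laurent P} x)); rewrite -xE.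
by rewrite -addrA; congr (_ + _); rewrite subrK.
Qed.
End Aug.
End Wpoly.

(** * Higman linearisation *)

Section Linearise.
Context {A : pzRingType}.

Section Block.
Context {P : lmodType A}.
Local Notation PP := (P * P)%type.
Let i1 : {linear P -> PP} := @inj1 A P P.
Let i2 : {linear P -> PP} := @inj2 A P P.
Let p1 : {linear PP -> P} := fst.
Let p2 : {linear PP -> P} := snd.

(** The block endomorphism [[0, k], [0, 0]] of P + P. *)
Definition corner (k : {linear P -> P}) : {linear PP -> PP} :=
  linear_comp i1 (linear_comp k p2).

(** The block endomorphism [[g, h], [-1, 0]] of P + P. *)
Definition companion (g h : {linear P -> P}) : {linear PP -> PP} :=
  linear_comp i1 (linear_comp g p1) + corner h - linear_comp i2 p1.

(** The coefficients of [[g, q], [-1, 0]], where q is the polynomial in w with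
    coefficients h :: l. *)
Definition companion_seq g h l := companion g h :: map corner l.

Local Notation F := (laurent_map p1).
Local Notation S := (laurent_map p2).

Lemma laurent_prod_eq (v v' : {laurent PP}) :
  F v = F v' -> S v = S v' -> v = v'.
Proof.
move=> Fv Sv; apply: laurent_eq => k; apply: injective_projections.
  by rewrite -!(coeff_laurent_map p1) Fv.
by rewrite -!(coeff_laurent_map p2) Sv.
Qed.

Lemma wpoly_corner1 l v : F (wpoly (map corner l) v) = wpoly l (S v).
Proof.
elim: l => [|k l IH]; first exact: linear0.
rewrite map_cons !wpoly_cons laurent_mapD laurent_map_wmap IH; congr (_ + _).
by rewrite !laurent_map_comp; apply: laurent_map_ext.
Qed.

Lemma wpoly_corner2 l v : S (wpoly (map corner l) v) = 0.
Proof.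
elim: l => [|k l IH]; first exact: linear0.
rewrite map_cons !wpoly_cons laurent_mapD laurent_map_wmap IH linear0 addr0.
by rewrite laurent_map_comp -[RHS](laurent_map0_fun v); apply: laurent_map_ext.
Qed.

Lemma wpoly_companion1 g h l v :
  F (wpoly (companion_seq g h l) v) =
  laurent_map g (F v) + wpoly (h :: l) (S v).
Proof.
rewrite /companion_seq !wpoly_cons laurent_mapD laurent_map_wmap.
rewrite wpoly_corner1 [RHS]addrA.
congr (_ + _); rewrite !laurent_map_comp -laurent_mapD_fun.
by apply: laurent_map_ext => x; rewrite /= subr0.
Qed.

Lemma wpoly_companion2 g h l v : S (wpoly (companion_seq g h l) v) = - F v.
Proof.
rewrite wpoly_cons laurent_mapD laurent_map_wmap wpoly_corner2 linear0 addr0.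
rewrite laurent_map_comp -laurent_mapN_fun.
by apply: laurent_map_ext => x; rewrite /= addr0 sub0r.
Qed.

Lemma laurent_pair (x y : {laurent P}) : exists v, F v = x /\ S v = y.
Proof.
have ji (f : {linear P -> P}) z : f =1 (fun=> 0) -> laurent_map f z = 0.
  by move=> fE; rewrite -[RHS](laurent_map0_fun z); apply: laurent_map_ext.
exists (laurent_map i1 x + laurent_map i2 y); split.
  rewrite laurent_mapD (laurent_map_comp p1 i1) (laurent_map_comp p1 i2).
  by rewrite laurent_map_id // ji // addr0.
rewrite laurent_mapD (laurent_map_comp p2 i1) (laurent_map_comp p2 i2).
by rewrite ji // add0r laurent_map_id.
Qed.

(** If the kernel of p is the image of 1 + w g + w^2 q, and c = [[g, q], [-1, 0]],
    then the kernel of (x, y) |-> p (x - w q y) is the image of 1 + w c.  The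
    maps F and S take the first and the second component. *)
Lemma higman_kernel (M : lmodType {laurent A}) (p : {linear {laurent P} -> M})
    (g q : {linear {laurent P} -> {laurent P}})
    (c : {linear {laurent PP} -> {laurent PP}}) :
  (forall v, F (c v) = g (F v) + q (S v)) -> (forall v, S (c v) = - F v) ->
  (forall x, p x = 0 <->
     exists u, u + (wmap _ (g u) + wmap _ (wmap _ (q u))) = x) ->
  forall v, p (F v - wmap _ (q (S v))) = 0 <-> exists u, u + wmap _ (c u) = v.
Proof.
move=> Fc Sc pP v.
have wD (x y : {laurent P}) : wmap _ (x + y) = wmap _ x + wmap _ y.
  exact: linearD.
have Fw u : F (u + wmap _ (c u)) =
    F u + (wmap _ (g (F u)) + wmap _ (q (S u))).
  by rewrite laurent_mapD laurent_map_wmap Fc wD.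
have Sw u : S (u + wmap _ (c u)) = S u - wmap _ (F u).
  by rewrite laurent_mapD laurent_map_wmap Sc linearN.
split=> [/pP[a aE]|[u <-]].
  (* (1 + w c) (a, b) = (x, y) forces b = y + w a, and then the first coordinate
     reduces to (1 + w g + w^2 q) a = x - w q y. *)
  have [u [uF uS]] := laurent_pair a (S v + wmap _ a).
  exists u; apply: laurent_prod_eq; last by rewrite Sw uF uS addrK.
  have qE : wmap _ (q (S u)) = wmap _ (q (S v)) + wmap _ (wmap _ (q a)).
    by rewrite uS (linearD q) wD (wmap_natural q).
  have swap (b x y z : {laurent P}) :
      a + (x + z) = b - y -> a + (x + (y + z)) = b.
    by move=> abE; rewrite [y + z]addrC !addrA -[a + x + z]addrA abE subrK.
  by rewrite Fw uF qE; exact: swap aE.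
apply/pP; exists (F u); rewrite Fw Sw.
have -> : wmap _ (q (S u - wmap _ (F u))) =
    wmap _ (q (S u)) - wmap _ (wmap _ (q (F u))).
  by rewrite (linearB q) (wmap_natural q) linearB.
have swap (b x y z : {laurent P}) : b + (x + z) = b + (x + y) - (y - z).
  by rewrite opprB -!addrA; congr (_ + (_ + _)); rewrite addrCA subrr addr0.
exact: swap.
Qed.

Variable M : lmodType {laurent A}.
Variable p : {linear {laurent P} -> M}.

(** The presentation (x, y) |-> p (x - w q y), where q is the polynomial in w
    with coefficients h :: l. *)
Definition companion_pres h l : {linear {laurent PP} -> M} :=
  linear_comp p ((laurent_map p1 : {linear _ -> _}) -
    linear_comp (wmap _) (linear_comp (wpoly (h :: l)) (laurent_map p2))).

Lemma companion_presE h l v :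
  companion_pres h l v = p (F v - wmap _ (wpoly (h :: l) (S v))).
Proof. by []. Qed.

Lemma companion_presP g h l :
  (forall x, p x = 0 <-> exists u, u + wmap _ (wpoly [:: g, h & l] u) = x) ->
  forall v, companion_pres h l v = 0 <->
    exists u, u + wmap _ (wpoly (companion_seq g h l) u) = v.
Proof.
move=> pP v; rewrite companion_presE; move: v.
apply: (@higman_kernel _ _ (laurent_map g)) => [v|v|x].
- exact: wpoly_companion1.
- exact: wpoly_companion2.
have dE u : wmap _ (wpoly [:: g, h & l] u) =
    wmap _ (laurent_map g u) + wmap _ (wmap _ (wpoly (h :: l) u)).
  exact: linearD.
by rewrite pP; split=> -[u <-]; exists u; rewrite dE.
Qed.

Lemma companion_pres_surj h l :
  (forall y, exists x, p x = y) -> forall y, exists v, companion_pres h l v = y.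
Proof.
move=> pS y; have [x xE] := pS y; have [v [Fv Sv]] := laurent_pair x 0.
exists v; rewrite companion_presE Fv Sv.
by rewrite (linear0 (wpoly _)) (linear0 (wmap _)) subr0.
Qed.
End Block.

(** A presentation by 1 + w q, with q a polynomial in w, yields one by a
    covering map.  The bound on the size of l drops by one at each
    linearisation; for a constant q = g the endomorphism is e = - g. *)
Lemma linearisation (M : lmodType {laurent A}) n (P : lmodType A)
    (l : seq {linear P -> P}) (p : {linear {laurent P} -> M}) :
  (size l <= n.+1)%N -> fg_projective P -> (forall y, exists x, p x = y) ->
  (forall x, p x = 0 <-> exists u, u + wmap _ (wpoly l u) = x) ->
  exists (X : seifert A) (p' : {linear {laurent X} -> M}),
    exact_at (covering_map X) p' /\ forall y, exists x, p' x = y.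
Proof.
have base (Q : lmodType A) (g : {linear Q -> Q})
    (r : {linear {laurent Q} -> M}) :
  fg_projective Q -> (forall y, exists x, r x = y) ->
  (forall x, r x = 0 <-> exists u, u + wmap _ (wpoly [:: g] u) = x) ->
  exists (X : seifert A) (p' : {linear {laurent X} -> M}),
    exact_at (covering_map X) p' /\ forall y, exists x, p' x = y.
  move=> Qfgp rS rP; exists (Seifert (- g) Qfgp), r; split=> // x.
  have cE u : covering_map (Seifert (- g) Qfgp) u = u + wmap _ (wpoly [:: g] u).
    by rewrite covering_mapE wpoly1 laurent_mapN_fun wmapE opprK scalerN addrA.
  by rewrite rP; split=> -[u uE]; exists u; rewrite -uE cE.
elim: n P l p => [|n IH] P l p sl Pfgp pS pP;
  case: l sl pP => [_ pP|g [_ pP|h l sl pP]].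
- apply: (base P 0 p Pfgp pS) => x; rewrite pP.
  by split=> -[u uE]; exists u; rewrite -uE wpoly1 laurent_map0_fun.
- exact: (base P g p Pfgp pS pP).
- by [].
- apply: (base P 0 p Pfgp pS) => x; rewrite pP.
  by split=> -[u uE]; exists u; rewrite -uE wpoly1 laurent_map0_fun.
- exact: (base P g p Pfgp pS pP).
apply: (IH _ (companion_seq g h l) (companion_pres p h l)).
- by rewrite /= size_map.
- exact: fg_projective_prod.
- exact: companion_pres_surj.
exact: companion_presP.
Qed.

(** * Every Blanchfield module is a covering *)

(** The map d(1) : P -> Q induced at z = 1 by d : P[z,z^-1] -> Q[z,z^-1]. *)
Definition aug_const (P Q : lmodType A)
  (d : {linear {laurent P} -> {laurent Q}}) (v : P) : Q := aug (d (zmonom 0 v)).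
Fact aug_const_linear (P Q : lmodType A)
  (d : {linear {laurent P} -> {laurent Q}}) : linear (@aug_const P Q d).
Proof.
move=> a x y; rewrite /aug_const -(aug_scale 0) -augD -linearP.
by rewrite -zmonomZ -raddfD.
Qed.
HB.instance Definition _ (P Q : lmodType A)
    (d : {linear {laurent P} -> {laurent Q}}) :=
  GRing.isLinear.Build A P Q *:%R (@aug_const P Q d) (aug_const_linear d).

Lemma aug_natural (P Q : lmodType A)
    (d : {linear {laurent P} -> {laurent Q}}) x :
  aug (d x) = aug_const d (aug x).
Proof.
elim/laurent_ind: x => [k v|x y xE yE].
  by rewrite aug_monom zmonomE linearZ aug_zpow.
by rewrite linearD !augD xE yE linearD.
Qed.

(** The modules of a resolution can be identified so that D(1) = 1. *)
Lemma blanchfield_normalise (M : lmodType {laurent A}) : is_blanchfield M ->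
  exists (P : lmodType A) (D : {linear {laurent P} -> {laurent P}})
    (p : {linear {laurent P} -> M}),
    [/\ fg_projective P, forall y, exists x, p x = y, exact_at D p
      & forall v, aug_const D v = v].
Proof.
move=> [wB [P1 [P0 [d [p [fgp1 fgp0 dI ex pS]]]]]].
have wI : injective (wmap M) := bij_inj wB.
(* v0 is the inverse of 1 - z on M. *)
have [v0 wK w'K] := wB.
have dS v : exists u, aug_const d u = v.
  have [y yE] := pS (v0 (p (zmonom 0 v))).
  have : p (zmonom 0 v - wmap _ y) = 0.
    by rewrite linearB wmap_natural yE [wmap M _]w'K subrr.
  move/ex => [u uE]; exists (aug u).
  by rewrite -aug_natural uE augB aug_monom aug_wmap subr0.
(* If d(1) v = 0 then d v = (1 - z) y, so y lies in the image of d and v in that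
   of 1 - z. *)
have d1I : injective (aug_const d).
  apply: raddf_inj => v v1.
  have [y] := wmap_aug (d (zmonom 0 v)).
  rewrite -[aug _]/(aug_const d v) v1 raddf0 add0r => yE.
  have /ex[u uE] : p y = 0.
    apply: wI; rewrite linear0 -wmap_natural -yE.
    by apply/ex; exists (zmonom 0 v).
  have : zmonom 0 v = wmap _ u by apply: dI; rewrite wmap_natural uE.
  by move/(congr1 aug); rewrite aug_monom aug_wmap.
have [g [gK Kg]] := linear_bijective_inverse d1I dS.
exists P0, (linear_comp d (laurent_map g)), p; split=> // [x|v].
  rewrite ex; split=> -[u uE]; last by exists (laurent_map g u).
  exists (laurent_map (aug_const d) u).
  by rewrite /= laurent_map_comp laurent_map_id.
by rewrite /aug_const /= laurent_map_monom -/(aug_const d _) Kg.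
Qed.

Lemma blanchfield_presentation (M : lmodType {laurent A}) : is_blanchfield M ->
  exists (X : seifert A) (p : {linear {laurent X} -> M}),
    exact_at (covering_map X) p /\ forall y, exists x, p x = y.
Proof.
move=> /blanchfield_normalise[P [D [p [Pfgp pS ex D1]]]].
have [n [l lE]] := linear_is_lpoly D Pfgp.
have lE' x : zpow n *: D x = wpoly l x by rewrite -lE.
(* The coefficient of w^0 is the value at z = 1, namely the identity; for l
   empty this forces P = 0. *)
have l1 x : wpoly l x = x + wmap _ (wpoly (behead l) x).
  have a1 v : aug (wpoly l (zmonom 0 v)) = v.
    by rewrite -lE' aug_zpow -[RHS]D1.
  case: l {lE lE'} a1 => [|h l] a1.
    have P0 (v : P) : v = 0 by rewrite -[v]a1 raddf0.
    apply: laurent_eq => k; rewrite [LHS]P0; exact/esym/P0.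
  rewrite wpoly_cons laurent_map_id // => v.
  rewrite -[RHS]a1 wpoly_cons augD aug_wmap addr0 laurent_map_monom.
  by rewrite aug_monom.
apply: (@linearisation M (size l) P (behead l) p) => //.
  by rewrite size_behead; lia.
move=> x; rewrite ex; split=> -[u uE].
  exists (zpow (- n%:Z) *: u).
  by rewrite -l1 -lE' linearZ zpowKN.
exists (zpow n *: u).
have -> : D (zpow n *: u) = zpow n *: D u by exact: linearZ.
by rewrite lE' l1.
Qed.
End Linearise.

(** * Preadditive categories and additive functors *)

Section Preadditive.
Context {C : preadditive}.

Lemma comp0m (X Y Z : C) (f : mor X Y) : (0 : mor Y Z) \oc f = 0.
Proof. by apply: (addIr ((0 : mor Y Z) \oc f)); rewrite -compDl !add0r. Qed.

Lemma compm0 (X Y Z : C) (f : mor Y Z) : f \oc (0 : mor X Y) = 0.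
Proof. by apply: (addIr (f \oc (0 : mor X Y))); rewrite -compDr !add0r. Qed.

Lemma expmS (X : C) (f : mor X X) n : f ^oc n.+1 = f \oc f ^oc n.
Proof. by []. Qed.

Lemma expmSr (X : C) (f : mor X X) n : f ^oc n.+1 = f ^oc n \oc f.
Proof.
elim: n => [|n IH]; first by rewrite /expm /= compm1 comp1m.
by rewrite expmS {1}IH Defs.compA.
Qed.

Lemma expmD (X : C) (f : mor X X) m n : f ^oc (m + n) = f ^oc m \oc f ^oc n.
Proof.
elim: m => [|m IH]; first by rewrite comp1m.
by rewrite addSn !expmS IH Defs.compA.
Qed.

Lemma inverses_expm (X : C) (t u : mor X X) n :
  inverses t u -> inverses (t ^oc n) (u ^oc n).
Proof.
move=> [ut tu]; suff E v w : v \oc w = idm X -> v ^oc n \oc w ^oc n = idm X.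
  by split; apply: E.
move=> vw; elim: n => [|n IH]; first by rewrite comp1m.
by rewrite expmSr expmS Defs.compA -(Defs.compA w v) vw compm1.
Qed.

(** Clearing powers of an invertible endomorphism in an equation of
    fractions. *)
Lemma comp_expm_eq (X Y : C) (a b : mor X Y) (t u : mor X X) m n :
  inverses t u ->
  a \oc u ^oc m = b \oc u ^oc n <-> a \oc t ^oc n = b \oc t ^oc m.
Proof.
move=> tu; have E v w (c d : mor X Y) k l : inverses v w ->
    c \oc w ^oc k = d \oc w ^oc l -> c \oc v ^oc l = d \oc v ^oc k.
  move=> vw cd.
  have [wk _] := inverses_expm k vw; have [wl _] := inverses_expm l vw.
  have -> : c \oc v ^oc l = c \oc w ^oc k \oc (v ^oc k \oc v ^oc l).
    by rewrite -Defs.compA (Defs.compA _ (v ^oc k)) wk comp1m.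
  rewrite cd -expmD addnC expmD -Defs.compA (Defs.compA _ (v ^oc l)) wl.
  by rewrite comp1m.
split; first exact: E.
by case: tu => ut tu; apply: E.
Qed.
End Preadditive.

Section AdditiveFunctor.
Context {C D : preadditive} (F : C -> D).
Context (Fm : forall X Y : C, mor X Y -> mor (F X) (F Y)).
Context (FmP : is_additive_functor Fm).

Lemma functor0 (X Y : C) : Fm (0 : mor X Y) = 0.
Proof.
case: FmP => _ _ FD.
by apply: (addIr (Fm (0 : mor X Y))); rewrite -FD !add0r.
Qed.

Lemma functorN (X Y : C) (f : mor X Y) : Fm (- f) = - Fm f.
Proof.
case: FmP => _ _ FD.
by apply: (addIr (Fm f)); rewrite -FD !addNr functor0.
Qed.

Lemma functor_expm (X : C) (f : mor X X) n : Fm (f ^oc n) = Fm f ^oc n.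
Proof.
case: FmP => F1 Fc _.
by elim: n => [|n IH]; rewrite ?F1 // expmS Fc IH.
Qed.

(** Zero objects and biproducts are described by equations between morphisms, so
    that any additive functor preserves them. *)
Lemma additive_category_transfer :
  is_additive_category C -> (forall M : D, exists X, isomorphic M (F X)) ->
  is_additive_category D.
Proof.
case: FmP => F1 Fc FD [[Z Z0] biprod] iso; split.
  have id0 : idm (F Z) = 0.
    have [[f [_ f1]] _] := Z0 Z.
    by rewrite -F1 -functor0; congr Fm; rewrite -(f1 (idm Z)) -?(f1 0).
  exists (F Z) => M; split; exists 0; split=> // f _.
    by rewrite -[f]comp1m id0 comp0m.
  by rewrite -[f]compm1 id0 compm0.
move=> M N; have [X [f [f' [ff f'f]]]] := iso M.
have [Y [h [h' [hh h'h]]]] := iso N.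
have [S [i1 [i2 [p1 [p2 [p1i1 p2i2 p2i1 p1i2 ip]]]]]] := biprod X Y.
exists (F S), (Fm i1 \oc f), (Fm i2 \oc h), (f' \oc Fm p1), (h' \oc Fm p2).
have mid (U V W : D) (V' W' : C) (a : mor (F W') U) (p : mor V' W') (X' : C)
  (i : mor X' V') (b : mor W (F X')) :
  (a \oc Fm p) \oc (Fm i \oc b) = a \oc Fm (p \oc i) \oc b.
  by rewrite Fc !Defs.compA.
have out (U : D) (X' Y' : C) (i : mor X' Y') (p : mor Y' X') (a : mor U (F X'))
    (a' : mor (F X') U) : a \oc a' = idm _ ->
    (Fm i \oc a) \oc (a' \oc Fm p) = Fm (i \oc p).
  by move=> aa; rewrite Fc -Defs.compA (Defs.compA _ a') aa comp1m.
split.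
- by rewrite mid // p1i1 F1 compm1.
- by rewrite mid // p2i2 F1 compm1.
- by rewrite mid // p2i1 functor0 compm0 comp0m.
- by rewrite mid // p1i2 functor0 compm0 comp0m.
by rewrite !out // -FD ip F1.
Qed.
End AdditiveFunctor.

Section SeifertAdditive.
Context {A : pzRingType}.

(** * The Seifert category is additive *)

Lemma fg_projective_zero : fg_projective 'rV[A]_0.
Proof.
have Z0 (x : 'rV[A]_0) : x = 0 by apply/rowP => -[].
split.
  by exists 0%N, (fun=> 0) => x; exists (fun=> 0); rewrite [x]Z0 big_ord0.
by move=> M N p f _; exists 0 => x; rewrite [x]Z0 !linear0.
Qed.

(** The zero object, carried by the rows of length 0. *)
Definition seifert_zero_object : seifert A := Seifert 0 fg_projective_zero.

Lemma seifert_zero_objectP :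
  is_zero_object (seifert_zero_object : seifert_category A).
Proof.
have Z0 (x : seifert_zero_object) : x = 0 by apply/rowP => -[].
move=> X; split; exists 0; split=> // f _; apply: seifert_hom_eq => x.
  by rewrite [RHS]Z0.
by rewrite [x]Z0 !linear0.
Qed.

Section Sum.
Variables X Y : seifert A.
Definition sum_endo (v : X * Y) : X * Y :=
  (seifert_endo X v.1, seifert_endo Y v.2).
Fact sum_endo_linear : linear sum_endo.
Proof. by move=> a x y; apply: injective_projections; rewrite /= linearP. Qed.
HB.instance Definition _ :=
  GRing.isLinear.Build A (X * Y)%type (X * Y)%type *:%R sum_endo
    sum_endo_linear.
(** The direct sum of two Seifert modules. *)
Definition seifert_sum : seifert A :=
  Seifert sum_endo (fg_projective_prod (seifert_fgp X) (seifert_fgp Y)).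

Fact seifert_inlP (x : X) :
  seifert_endo seifert_sum (inj1 Y x) = inj1 Y (seifert_endo X x).
Proof. by apply: injective_projections; rewrite //= linear0. Qed.
Fact seifert_inrP (y : Y) :
  seifert_endo seifert_sum (inj2 X y) = inj2 X (seifert_endo Y y).
Proof. by apply: injective_projections; rewrite //= linear0. Qed.
Fact seifert_fstP (v : seifert_sum) :
  seifert_endo X v.1 = (seifert_endo seifert_sum v).1.
Proof. by []. Qed.
Fact seifert_sndP (v : seifert_sum) :
  seifert_endo Y v.2 = (seifert_endo seifert_sum v).2.
Proof. by []. Qed.

Lemma seifert_sumP : exists (i1 : seifert_hom X seifert_sum)
   (i2 : seifert_hom Y seifert_sum) (p1 : seifert_hom seifert_sum X)
   (p2 : seifert_hom seifert_sum Y),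
  @is_biproduct (seifert_category A) X Y seifert_sum i1 i2 p1 p2.
Proof.
exists (@SeifertHom _ X seifert_sum (@inj1 A X Y) seifert_inlP).
exists (@SeifertHom _ Y seifert_sum (@inj2 A X Y) seifert_inrP).
exists (@SeifertHom _ seifert_sum X (@fst X Y) seifert_fstP).
exists (@SeifertHom _ seifert_sum Y (@snd X Y) seifert_sndP).
split; apply: seifert_hom_eq => // -[x y].
by apply: injective_projections; rewrite /= ?addr0 ?add0r.
Qed.
End Sum.

Lemma seifert_additive : is_additive_category (seifert_category A).
Proof.
split; first by exists seifert_zero_object; exact: seifert_zero_objectP.
move=> X Y; have [i1 [i2 [p1 [p2 P]]]] := seifert_sumP X Y.
by exists (seifert_sum X Y : seifert_category A), i1, i2, p1, p2.
Qed.
End SeifertAdditive.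

Section Main.
Context (A : pzRingType).

(** * The covering functor *)

Lemma covering_is_blanchfield (X : seifert A) : is_blanchfield (covering X).
Proof.
split.
  have uE := @covering_endo_inv A X.
  exists (covering_hom (endo_hom X)) => x; last first.
    by rewrite -[RHS]uE scalerBl scale1r.
  rewrite -[RHS]uE -linearZ; congr covering_hom.
  by rewrite scalerBl scale1r.
exists X, X, (covering_map X), (coker_proj (covering_map X)); split.
- exact: seifert_fgp.
- exact: seifert_fgp.
- exact: covering_map_inj.
- move=> y; rewrite -(raddf0 (coker_proj (covering_map X))) coker_projP subr0.
  by [].
exact: coker_proj_surj.
Qed.

Let F : seifert_category A -> blanchfield_category A :=
  covering_functor covering_is_blanchfield.
Let B (X X' : seifert_category A) (g : mor X X') : mor (F X) (F X') :=
  covering_functor_hom covering_is_blanchfield g.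

Lemma covering_additive_functor : is_additive_functor B.
Proof.
split=> [X|X Y Z g f|X Y f g]; apply: linear_eq.
- apply: (@covering_hom_eq _ _ _ (covering_hom _) (linear_id _)) => v.
  exact: covering_hom_const.
- apply: (@covering_hom_eq _ _ _ (covering_hom _)
    (linear_comp (covering_hom g) (covering_hom f))) => v.
  rewrite [LHS]covering_hom_const [RHS]/= covering_hom_const.
  by rewrite covering_hom_const.
apply: (@covering_hom_eq _ _ _ (covering_hom _)
  ((covering_hom f : {linear _ -> _}) +
   (covering_hom g : {linear _ -> _}))) => v.
rewrite [LHS]covering_hom_const linear_addE /= !covering_hom_const.
exact: const_classD.
Qed.

Lemma blanchfield_is_covering (M : blanchfield_category A) :
  exists X : seifert_category A, isomorphic M (F X).
Proof.
have [X [p [ex pS]]] := blanchfield_presentation (blanchfieldP M).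
exists X.
have pd x : p (covering_map X x) = 0 by apply/ex; exists x.
pose f : {linear covering X -> M} := coker_lift pd.
have fE x : f (coker_proj (covering_map X) x) = p x by exact: coker_liftE.
have fI : injective f.
  suff fker q : f q = 0 -> q = 0 by exact: raddf_inj fker.
  have [x <-] := coker_proj_surj q.
  rewrite fE => /ex[u uE].
  rewrite -(raddf0 (coker_proj (covering_map X))); apply/coker_projP.
  by exists u; rewrite subr0.
have fS y : exists q, f q = y.
  have [x xE] := pS y; exists (coker_proj (covering_map X) x).
  by rewrite fE.
have [g [gK Kg]] := linear_bijective_inverse fI fS.
by exists g, f; split; apply: linear_eq => x; [exact: Kg|exact: gK].
Qed.
End Main.

Theorem theorem1p8 (A : pzRingType) :
  is_additive_category (seifert_category A) /\
  is_additive_category (blanchfield_category A) /\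
  exists covP : forall X : seifert A, is_blanchfield (covering X),
    let F (X : seifert_category A) : blanchfield_category A :=
      covering_functor covP X in
    let B (X X' : seifert_category A) (g : mor X X') : mor (F X) (F X') :=
      covering_functor_hom covP g in
    let e (X : seifert_category A) : mor X X := seifert_self X in
    let s (X : seifert_category A) : mor X X := e X \oc (idm X - e X) in
    let z (M : blanchfield_category A) : mor M M := blanchfield_z M in
    let zinv (M : blanchfield_category A) : mor M M := blanchfield_zinv M in
    let t (X : seifert_category A) : mor (F X) (F X) := B X X (s X) in
    let tinv (X : seifert_category A) : mor (F X) (F X) :=
      (idm (F X) - z (F X)) \oc (idm (F X) - zinv (F X)) in
    is_additive_functor B /\
    (* (i) *)
    (forall M : blanchfield_category A,
       exists X : seifert_category A, isomorphic M (F X)) /\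
    (* (ii) *)
    (forall X : seifert_category A,
       inverses (B X X (e X)) (idm (F X) - z (F X)) /\
       inverses (B X X (idm X - e X)) (idm (F X) - zinv (F X))) /\
    (* (iii) *)
    (forall X : seifert_category A, inverses (t X) (tinv X)) /\
    (forall (X X' : seifert_category A) (f : mor (F X) (F X')),
       exists (g : mor X X') (k : nat), f = B X X' g \oc tinv X ^oc k) /\
    (* (iv) *)
    (forall (X X' : seifert_category A) (g1 g2 : mor X X') (k1 k2 : nat),
       B X X' g1 \oc tinv X ^oc k1 = B X X' g2 \oc tinv X ^oc k2 <->
       exists l : nat,
         (g1 \oc s X ^oc k2 - g2 \oc s X ^oc k1) \oc s X ^oc l = 0).
Proof.
split; first exact: seifert_additive.
have FB := covering_additive_functor A.
split.
  exact: (additive_category_transfer FB (seifert_additive (A := A))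
    (@blanchfield_is_covering A)).
exists (@covering_is_blanchfield A) => F B e s z zinv t tinv.
have zE (X : seifert_category A) (x : covering X) :
    (idm (F X) - z (F X) : {linear covering X -> covering X}) x =
    (1 - zpow 1) *: x by rewrite scalerBl scale1r.
have zinvE (X : seifert_category A) (x : covering X) :
    (idm (F X) - zinv (F X) : {linear covering X -> covering X}) x =
    (1 - zpow (- 1)) *: x by rewrite scalerBl scale1r.
have eP (X : seifert_category A) : inverses (B X X (e X)) (idm (F X) - z (F X)).
  have uE := @covering_endo_inv A X.
  split; apply: linear_eq => x.
    by rewrite -[RHS]uE -zE.
  by rewrite -[RHS]uE -linearZ -zE.
have cP (X : seifert_category A) :
    inverses (B X X (idm X - e X)) (idm (F X) - zinv (F X)).
  have uE := @covering_coendo_inv A X.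
  split; apply: linear_eq => x.
    by rewrite -[RHS]uE -zinvE.
  by rewrite -[RHS]uE -linearZ -zinvE.
have tP (X : seifert_category A) : inverses (t X) (tinv X).
  have uE := @covering_sendo_inv A X.
  have tinvE x : (tinv X : {linear covering X -> covering X}) x =
      (1 - zpow 1) *: ((1 - zpow (- 1)) *: x) by rewrite -zinvE -zE.
  split; apply: linear_eq => x.
    by rewrite -[RHS]uE -tinvE.
  transitivity (covering_hom (sendo_hom X)
      ((1 - zpow 1) *: ((1 - zpow (- 1)) *: x))); first by rewrite -tinvE.
  by rewrite -[RHS]uE linearZ; congr (_ *: _); exact: linearZ.
split; first exact: FB.
split; first exact: blanchfield_is_covering.
split; first by [].
split; first exact: tP.
split.
  move=> X X' f.
  have [g [k gP]] :=
    covering_hom_full (f : {linear covering X -> covering X'}).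
  exists g, k.
  have tE x : (t X ^oc k : {linear covering X -> covering X}) x =
      iter k (covering_hom (sendo_hom X)) x.
    by elim: (k) => //= n <-.
  have [_ tk] := inverses_expm k (tP X).
  rewrite -[f]compm1 -tk Defs.compA; congr (_ \oc _).
  by apply: linear_eq => x; rewrite -[RHS]gP -tE.
move=> X X' g1 g2 k1 k2; rewrite (comp_expm_eq _ _ _ _ (tP X)).
have BE : B X X' (g1 \oc s X ^oc k2 - g2 \oc s X ^oc k1) =
    B X X' g1 \oc t X ^oc k2 - B X X' g2 \oc t X ^oc k1.
  case: (FB) => _ Fc FD.
  have Bs g k : B X X' (g \oc s X ^oc k) = B X X' g \oc t X ^oc k.
    apply: etrans (Fc _ _ _ _ _) _; congr (_ \oc _).
    exact: (functor_expm FB).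
  rewrite -!Bs; apply: etrans (FD _ _ _ _) _; congr (_ + _).
  exact: (functorN FB).
have sE l x : (s X ^oc l : seifert_hom X X) x = iter l (sendo X) x.
  by elim: l => //= l <-.
have B0 (h : seifert_hom X X') : B X X' h = 0 <->
    exists l, (h : mor X X') \oc s X ^oc l = 0.
  apply: iff_trans (iff_trans _ (covering_hom_eq0P h)) _.
    split=> [b x|b]; last by apply: linear_eq.
    by have := congr1 (fun k : {linear covering X -> covering X'} => k x) b.
  split=> -[l lP]; exists l.
    by apply: seifert_hom_eq => v; rewrite /= sE lP.
  by move=> v; rewrite -sE; have := congr1 (fun k : seifert_hom X X' => k v) lP.
apply: iff_trans (B0 _); rewrite BE.
by split=> [->|/eqP]; [rewrite subrr | rewrite subr_eq0 => /eqP].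
Qed.
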